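(* If $G$ is a finite simple quasi-line graph, then the competition number of $G$ is at most $2$.
   Context: A clique is a set of vertices that induces a complete graph. A quasi-line graph is a graph in which the (open) neighborhood of every vertex can be partitioned into at most two cliques. The competition graph of an acyclic directed graph $D$ is the undirected graph on the same vertex set as $D$ in which two distinct vertices $u,v$ are adjacent if and only if there is a vertex $w$ such that $(u,w)$ and $(v,w)$ are arcs of $D$. The competition number of an undirected graph $G$ is the least number $k\ge 0$ of isolated vertices that have to be added to $G$ so that the resulting graph is the competition graph of an acyclic directed graph. All graphs are finite and simple. *)

(* Defs.v *)
From mathcomp Require Import all_boot.
From mathcomp Require Import boolp.

Set Implicit Arguments.
Unset Strict Implicit.
Unset Printing Implicit Defensive.

Record sgraph := SGraph {
  vertex :> finType;
  adj : rel vertex;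
  adj_sym : symmetric adj;
  adj_irrefl : irreflexive adj
}.

Definition neighborhood (G : sgraph) (v : G) : {set G} := [set u | adj v u].

Definition clique (G : sgraph) (K : {set G}) : Prop :=
  {in K &, forall x y, x != y -> adj x y}.

(* [A] and [B] may be empty, so "at most two cliques" is covered. *)
Definition quasi_line (G : sgraph) : Prop :=
  forall v : G, exists A B : {set G},
    [/\ clique A, clique B, [disjoint A & B] & A :|: B = neighborhood v].

(* [ucycle d c] ranges over the directed cycles without repeated vertices;
   [:: x] is a loop and [:: x; y] a pair of opposite arcs. *)
Definition acyclic (V : finType) (d : rel V) : Prop :=
  forall c : seq V, ucycle d c -> c = [::].

Definition competition_adj (V : finType) (d : rel V) : rel V :=
  fun u v => (u != v) && [exists w, d u w && d v w].

Lemma competition_adj_sym (V : finType) (d : rel V) :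
  symmetric (competition_adj d).
Proof.
move=> u v; rewrite /competition_adj eq_sym; congr (_ && _).
by apply: eq_existsb => w; rewrite andbC.
Qed.

Lemma competition_adj_irrefl (V : finType) (d : rel V) :
  irreflexive (competition_adj d).
Proof. by move=> u; rewrite /competition_adj eqxx. Qed.

Definition competition_graph (V : finType) (d : rel V) : sgraph :=
  SGraph (competition_adj_sym d) (competition_adj_irrefl d).

Definition add_isolated_adj (G : sgraph) (k : nat) : rel (G + 'I_k)%type :=
  fun a b => match a, b with inl u, inl v => adj u v | _, _ => false end.

Lemma add_isolated_adj_sym (G : sgraph) (k : nat) :
  symmetric (@add_isolated_adj G k).
Proof. by case=> [u|i] [v|j] //=; rewrite adj_sym. Qed.

Lemma add_isolated_adj_irrefl (G : sgraph) (k : nat) :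
  irreflexive (@add_isolated_adj G k).
Proof. by case=> [u|i] //=; rewrite adj_irrefl. Qed.

Definition add_isolated (G : sgraph) (k : nat) : sgraph :=
  SGraph (@add_isolated_adj_sym G k) (@add_isolated_adj_irrefl G k).

Definition is_competition_graph (H : sgraph) : Prop :=
  exists2 d : rel H, acyclic d & @adj H =2 @adj (competition_graph d).

(* One new common out-neighbour for each ordered pair of adjacent vertices. *)
Lemma ex_competition (G : sgraph) :
  exists k : nat, `[< is_competition_graph (add_isolated G k) >].
Proof.
exists #|{: G * G}|; apply/asboolP.
pose d : rel (add_isolated G #|{: G * G}|) := fun a b =>
  match a, b with
  | inl u, inr i => let xy := enum_val i in
      adj xy.1 xy.2 && ((u == xy.1) || (u == xy.2))
  | _, _ => false
  end.
exists d.
  case=> [//|a [|b c]] /andP[/= /andP[dab H] _]; first by case: a dab H.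
  by case: a b dab H => [a|i] [b|j] //= _; case: c => [|[]].
case=> [u|i] [v|j] /=; rewrite /competition_adj.
- apply/idP/andP => [uv|[neq_uv /existsP[[w|i] //= /andP[]]]].
    split; first by apply: contraTneq uv => -[->]; rewrite adj_irrefl.
    apply/existsP; exists (inr (enum_rank (u, v))).
    by rewrite /= !enum_rankK /= uv !eqxx orbT.
  have {neq_uv} : u != v by apply: contraNneq neq_uv => ->.
  move=> neq_uv /andP[a12 u12] /andP[_ v12]; move: neq_uv.
  by case/orP: u12 => /eqP->; case/orP: v12 => /eqP->; rewrite ?eqxx // adj_sym.
- by apply/esym/negbTE/negP => /andP[_ /existsP[w]]; rewrite andbF.
- by apply/esym/negbTE/negP => /andP[_ /existsP[w]].
- by apply/esym/negbTE/negP => /andP[_ /existsP[w]].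
Qed.

Definition competition_number (G : sgraph) : nat := ex_minn (ex_competition G).

(* Main.v *)
Require Import Defs.
From mathcomp Require Import all_boot.
From mathcomp Require Import boolp.
Set Implicit Arguments.
Unset Strict Implicit.
Unset Printing Implicit Defensive.

(** Adding two isolated vertices to [G] yields the competition graph of an
acyclic digraph as soon as the vertices can be listed, and the edges covered by
cliques [F 0], [F 1], ..., so that every edge at the vertex in position [i] is
covered by some [F j] with [j <= i + 1]: for [j >= 2] all of [F j] that matters
comes after position [j - 2], so the vertex there can serve as a common prey of
[F j], and the two new vertices serve [F 0] and [F 1].  Such a schedule is built
from pieces.  A nonempty set of vertices whose edges can be scheduled with no
more cliques than vertices is called a slack; it can be put first and deleted,
after which the rest of the graph is scheduled with the same budget.  So it
suffices to find a slack in every quasi-line graph with an edge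
([edge_slack]).

In the line graph of a multigraph with minimum degree at least two, a slack is
the edge set of a cycle: each edge lies in two stars, and a cycle has as many
vertices as edges.  In general every vertex [w] has two maximal cliques whose
union is its closed neighbourhood, its ends.  If each end of each vertex is also
an end of another vertex, a walk that leaves every vertex through the end it did
not enter by must close up, and this is a slack ([walk_step]).  It remains to
find a slack when an end is not shared, and there are two ways for this to
happen.

The first is that [A] is an end of [w] such that for no other vertex of [A] the
neighbours outside [A] form a clique.  An extremal choice of vertices of [A]
then gives a square p p' q' q in the neighbourhood of [w] together with
vertices outside that neighbourhood which determine how the square is to be
split into two cliques ([stuck_anchored]).  From the square one grows a
homogeneous pair of cliques [X], [Y]: as long as some vertex is adjacent to a
part of [Y] only, it turns out to be adjacent to all of [X] and can be added to
[X], and symmetrically ([anchored_linked], [linked_extend]).  A vertex outside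
the final pair does not distinguish the members of [X], nor those of [Y], so one
clique containing [X], one clique for each member of [X] and one clique
containing [Y] cover everything at [X] and [Y]; as [Y] has two members, this is
a slack ([saturated_linked_slack]).

The second is that [A] does serve another vertex [p], but [p] splits its
neighbourhood differently.  Then the neighbourhood of [p] is the join of two
parts that are not cliques, and without a square of the first kind the whole
component of [p] is covered by two cliques, which gives a slack at once
([colourings_rigid]). *)

(** * Two-clique neighbourhoods *)

Section QuasiLine.
Variables (V : finType) (e : rel V).

(** Adjacency with equality allowed, so that statements about cliques and
colourings carry no distinctness conditions. *)
Definition near x y := (x == y) || e x y.

(** The colour classes of [s] split the neighbourhood of [v] into two cliques;
nothing is asked of [s] elsewhere, and [v] may have many such colourings. *)
Definition halves v (s : V -> bool) :=
  forall a b, e v a -> e v b -> s a = s b -> near a b.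

Definition clq (K : {set V}) := {in K &, forall x y, near x y}.

Hypotheses (e_sym : symmetric e) (e_irr : irreflexive e).
Hypothesis ql : forall v, exists s, halves v s.

Lemma near_sym : symmetric near.
Proof. by move=> x y; rewrite /near eq_sym e_sym. Qed.

Lemma nearxx x : near x x.
Proof. by rewrite /near eqxx. Qed.

Lemma e_near x y : e x y -> near x y.
Proof. by rewrite /near => ->; rewrite orbT. Qed.

Lemma near_e x y : near x y -> x != y -> e x y.
Proof. by rewrite /near => /orP[->|]. Qed.

Lemma nearE x y : near x y -> x = y \/ e x y.
Proof. by case/predU1P; [left|right]. Qed.

Lemma near_sep x y z : near x y -> ~~ near x z -> y != z.
Proof. by move=> xy; apply: contraNneq => <-. Qed.

Lemma near_e_sep x y z : near x y -> near y z -> ~~ near x z -> e x y.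
Proof.
by move=> xy yz nxz; apply: near_e => //; apply: contraNneq nxz => ->.
Qed.

Lemma halvesN v s a b :
  halves v s -> e v a -> e v b -> ~~ near a b -> s a = ~~ s b.
Proof.
move=> hs va vb; apply: contraNeq => sab; apply: (hs _ _ va vb).
by case: (s a) (s b) sab => [] [].
Qed.

Lemma no_claw v a b c : e v a -> e v b -> e v c ->
  ~~ near a b -> ~~ near b c -> near a c.
Proof.
move=> va vb vc nab nbc; have [s hs] := ql v; apply: (hs _ _ va vc).
by rewrite (halvesN hs va vb nab) (halvesN hs vb vc nbc) negbK.
Qed.

Lemma halves_true v a : exists2 s, halves v s & s a.
Proof.
have [s hs] := ql v; case sa: (s a); first by exists s.
exists (fun x => ~~ s x); rewrite ?sa // => x y vx vy /negb_inj; exact: hs.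
Qed.

(** * Schedules and slacks *)

(** Covering an edge by a clique of index at most one more than the position of
an endpoint leaves, for every [j >= 2], a vertex of the list that precedes all
vertices using [F j].  The bound [n] counts the cliques. *)
Definition schedules (s : seq V) (F : nat -> {set V}) n :=
  [/\ uniq s, forall j, clq (F j) & {in s, forall x v, e x v ->
     exists j, [/\ j <= (index x s).+1, j < n, x \in F j & v \in F j]}].

(** A schedule that touches at most one clique more than the vertices listed so
far, and has made up for that one clique at its end. *)
Definition slack := exists s F,
  [/\ s != [::], {in s, forall x, exists v, e x v} & schedules s F (size s)].

(** List [X] first: the clique [L] and, for each [x] in [X], the clique formed
by [x] and its neighbours outside [L] cover all edges at [X], which is one
clique too many.  Then [y1] and [y2] share the single new clique [R], since all
their other edges lie in cliques already paid for. *)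
Lemma slack_pair (L R X : {set V}) y1 y2 :
  clq L -> clq R -> X \subset L -> {in X, forall x, exists v, e x v} ->
  {in X, forall x, clq [set v | e x v & v \notin L]} ->
  y1 != y2 -> y1 \in R :\: X -> y2 \in R :\: X ->
  (forall y v, y \in [:: y1; y2] -> e y v ->
     [\/ v \in X, v \in R |
         exists2 x, x \in X & [/\ e x y, e x v, y \notin L & v \notin L]]) ->
  slack.
Proof.
move=> cL cR sXL X_nbr X_good ny; rewrite !inE => /andP[y1X y1R] /andP[y2X y2R] y_nbr.
pose K x := x |: [set v | e x v & v \notin L].
have cK x : x \in X -> clq (K x).
  move=> xX u v; rewrite !inE => /orP[/eqP->|/andP[xu uL]] /orP[/eqP->|/andP[xv vL]].
  - exact: nearxx.
  - exact: e_near.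
  - by rewrite near_sym e_near.
  - by apply: (X_good x xX); rewrite inE ?xu ?xv.
pose s := enum X ++ [:: y1; y2].
pose F j := if j is k.+1 then
  if k < #|X| then K (nth y1 (enum X) k) else R else L.
have szX : size (enum X) = #|X| by rewrite -cardE.
have us : uniq s.
  by rewrite cat_uniq enum_uniq /= !mem_enum !inE (negbTE y1X) (negbTE y2X) ny.
have FX x v : x \in X -> e x v -> exists j,
    [/\ j <= (index x (enum X)).+1, j < #|X|.+1, x \in F j & v \in F j].
  move=> xX xv; have xE : x \in enum X by rewrite mem_enum.
  have [vL|vL] := boolP (v \in L).
    by exists 0; split=> //=; apply: (subsetP sXL).
  have ix : index x (enum X) < #|X| by rewrite -szX index_mem.
  exists (index x (enum X)).+1; split=> //=; rewrite ix nth_index //.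
    by rewrite !inE eqxx.
  by rewrite !inE xv vL orbT.
exists s, F; split.
- by rewrite /s; case: (enum X).
- move=> x; rewrite mem_cat mem_enum => /orP[/X_nbr //|]; rewrite !inE.
  by case/orP=> /eqP->; [exists y2|exists y1]; apply: near_e; rewrite ?cR // eq_sym.
split=> //.
- case=> [|k] /=; first exact: cL.
  by case: ifP => [kX|_] //; apply: cK; rewrite -mem_enum mem_nth // szX.
move=> x; rewrite mem_cat mem_enum => /orP[xX|xy] v xv.
  have [j [jx jX xF vF]] := FX x v xX xv.
  exists j; split=> //; first by rewrite index_cat mem_enum xX.
  by rewrite size_cat szX addn2 ltnS ltnW.
have [xX xR] : x \notin X /\ x \in R by move: xy; rewrite !inE => /orP[] /eqP->.
have ixs : #|X| <= index x s.
  by rewrite index_cat mem_enum (negbTE xX) szX leq_addr.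
case: (y_nbr x v xy xv) => [vX|vR|[z zX [zx zv xL vL]]].
- have xv' : e v x by rewrite e_sym.
  have [j [jx jX vF xF]] := FX v x vX xv'; exists j; split=> //.
    by apply: leqW; apply: leq_trans ixs; rewrite -ltnS.
  by rewrite size_cat szX addn2 ltnS ltnW.
- exists #|X|.+1; split=> //=; rewrite ?ltnn //.
  by rewrite size_cat szX addn2.
- have zE : z \in enum X by rewrite mem_enum.
  have iz : index z (enum X) < #|X| by rewrite -szX index_mem.
  exists (index z (enum X)).+1; split=> /=; rewrite ?iz ?nth_index //.
  + by rewrite ltnS (leq_trans (ltnW iz)).
  + by rewrite size_cat szX addn2 ltnS leqW.
  + by rewrite !inE zx xL orbT.
  + by rewrite !inE zv vL orbT.
Qed.

(** * Linked pairs of cliques *)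
Definition all_near (X : {set V}) v := [forall x in X, near v x].
Definition some_near (X : {set V}) v := [exists x in X, near v x].

Lemma all_nearP {X : {set V}} {v} : reflect {in X, forall x, near v x} (all_near X v).
Proof. exact: forall_inP. Qed.
Lemma some_nearP {X : {set V}} {v} :
  reflect (exists2 x, x \in X & near v x) (some_near X v).
Proof. exact: exists_inP. Qed.

Lemma all_some_near X v : X != set0 -> all_near X v -> some_near X v.
Proof.
by case/set0Pn=> x xX /all_nearP aX; apply/some_nearP; exists x => //; apply: aX.
Qed.

(** The nonadjacent partners keep [X] and [Y] apart: no member of [X] is near to
all of [Y], so membership never has to be excluded separately below. *)
Definition interlocked (X Y : {set V}) :=
  [/\ clq X, X != set0
    & {in X, forall x, some_near Y x && ~~ all_near Y x}].

Definition mixed X v := some_near X v && ~~ all_near X v.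

(** Seen from a member of [X], the neighbourhood splits into the side of [X] and
the side of [Y].  A hub, that is a vertex near to all of [X] and of [Y], may be
on either side; [a] is the set of hubs placed on the side of [X].  Vertices near
to all of [X] but not of [Y] are on the side of [X], and vertices near to all
of [Y] and only to a part of [X] on the other. *)
Definition sideL (X Y a : {set V}) v :=
  all_near X v && (all_near Y v ==> (v \in a)).
Definition sideK (X Y a : {set V}) v :=
  [&& all_near Y v, some_near X v & all_near X v ==> (v \notin a)].

Definition coloured (X Y a : {set V}) :=
  (forall u v, sideL X Y a u -> sideL X Y a v -> near u v) /\
  (forall u v, sideK X Y a u -> sideK X Y a v -> near u v).

(** Members of [X] and of [Y] may disagree about a hub: one lying between [X]
and [Y] is opposite to the outer neighbours of both.  Hence a linked pair has
two colourings of the hubs, [a] for the point of view of [X] and [b] for that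
of [Y].  The middle condition is what makes it possible to enlarge the pair by
a vertex that distinguishes members of [X] or of [Y]. *)
Definition half_linked X Y a :=
  [/\ interlocked X Y, forall v, mixed X v -> all_near Y v & coloured X Y a].

Definition linked X Y a b := half_linked X Y a /\ half_linked Y X b.

Lemma linked_sym X Y a b : linked X Y a b -> linked Y X b a.
Proof. by case. Qed.

Definition agree (X Y a b : {set V}) u :=
  [&& all_near X u, all_near Y u & (u \in a) == (u \in b)].

Lemma agree_sym X Y a b u : agree X Y a b u = agree Y X b a u.
Proof. by rewrite /agree eq_sym andbCA. Qed.

Section Pair.
Variables (X Y a b : {set V}).
Hypothesis hp : linked X Y a b.

Lemma linked_neq0l : X != set0. Proof. by case: hp => -[[]]. Qed.
Lemma linked_neq0r : Y != set0. Proof. by case: hp => _ [[]]. Qed.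

(** Nonadjacent hubs get different colours in [a] and in [b], so either both of
them or neither of them is coloured alike by [a] and [b]. *)
Lemma agree_hub u v : agree X Y a b u -> all_near X v -> all_near Y v ->
  ~~ agree X Y a b v -> near u v.
Proof.
case: hp => -[_ _ [L K]] [_ _ [L' K']].
case/and3P=> uX uY /eqP uab vX vY; rewrite /agree vX vY /= => vab.
have sX w : all_near X w -> some_near X w by apply: all_some_near linked_neq0l.
have sY w : all_near Y w -> some_near Y w by apply: all_some_near linked_neq0r.
have [ua|ua] := boolP (u \in a); have [va|va] := boolP (v \in a).
- by apply: L; rewrite /sideL ?uX ?uY ?vX ?vY ?ua ?va.
- apply: L'; rewrite /sideL ?uX ?uY ?vX ?vY -?uab ?ua //.
  by case: (v \in b) vab; rewrite ?(negbTE va).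
- apply: K'; rewrite /sideK ?uX ?uY ?vX ?vY ?sY // -?uab ?ua //.
  by move: vab; rewrite va; case: (v \in b).
- by apply: K; rewrite /sideK ?uX ?uY ?vX ?vY ?sX ?ua ?va.
Qed.

Lemma agree_mixed u v : agree X Y a b u -> all_near X v -> mixed Y v ->
  near u v.
Proof.
case: hp => -[_ _ [L K]] [_ _ [L' K']].
case/and3P=> uX uY /eqP uab vX /andP[vY nvY].
have [ua|ua] := boolP (u \in a).
  by apply: L; rewrite /sideL ?uX ?vX ?(negbTE nvY) ?ua ?implybT.
apply: K'; rewrite /sideK ?uX ?uY ?vX ?vY ?(negbTE nvY) //.
by rewrite (all_some_near linked_neq0r uY) -uab ua.
Qed.

End Pair.

Lemma all_nearPn {X : {set V}} {v} :
  ~~ all_near X v -> exists2 x, x \in X & ~~ near v x.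
Proof. by move/forall_inPn. Qed.

Lemma some_nearPn {X : {set V}} {v x} : ~~ some_near X v -> x \in X -> ~~ near v x.
Proof. by move=> /exists_inPn; apply. Qed.

Lemma interlocked_far X Y x : interlocked X Y -> x \in X -> exists2 y, y \in Y & ~~ near x y.
Proof. by case=> _ _ h /h /andP[_ /all_nearPn]. Qed.

(** The hubs coloured alike by [a] and [b] are near to all other hubs and to all
mixed vertices, so they can be recoloured as a block, for instance in the way
their common neighbour [h] splits its own neighbourhood.  The new colouring is
compatible with the vertices beyond [Y] that are adjacent to [h]. *)
Lemma recolour X Y a b h y0 : linked X Y a b -> sideL X Y a h ->
  ~~ agree X Y a b h -> y0 \in Y -> near h y0 ->
  exists a', [/\ linked X Y a' b,
    forall u, agree X Y a' b u -> agree X Y a b u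
  & forall u r, all_near X u -> all_near Y u -> u \notin a' ->
      all_near Y r -> ~~ some_near X r -> near h r -> near u r].
Proof.
move=> hp hL hE y0Y hy0; have /andP[hX _] := hL.
have [[cXY mX [L K]] [cYX mY [L' K']]] := hp.
have [x0 x0X x0y0] := interlocked_far cYX y0Y.
have [s hs] := ql h.
have ey0 : e h y0 by rewrite near_sym in hy0; rewrite e_sym;
  apply: near_e_sep hy0 _ x0y0; apply: (all_nearP hX).
have hsX : some_near X h by apply: all_some_near hX; case: cXY.
have hsY : some_near Y h by apply/some_nearP; exists y0.
have hEn u : agree X Y a b u -> e h u.
  move=> uE; apply: near_e; last by apply: contraNneq hE => ->.
  rewrite near_sym; have [hY|hY] := boolP (all_near Y h).
    exact: (agree_hub hp).
  by apply: (agree_mixed hp) => //; apply/andP.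
pose a' := [set u | if agree X Y a b u then s u != s y0 else u \in a].
have a'E u : agree X Y a b u -> (u \in a') = (s u != s y0).
  by move=> uE; rewrite inE uE.
have a'N u : ~~ agree X Y a b u -> (u \in a') = (u \in a).
  by move=> uE; rewrite inE (negbTE uE).
have ex x : x \in X -> ~~ near y0 x -> e h x.
  move=> xX nyx; apply: near_e; first exact: (all_nearP hX).
  by apply: contraNneq nyx => <-; rewrite near_sym.
have EE u v : agree X Y a b u -> agree X Y a b v ->
    (u \in a') = (v \in a') -> near u v.
  move=> uE vE; rewrite !a'E // => uv; apply: (hs u v (hEn u uE) (hEn v vE)).
  by case: (s u) (s v) (s y0) uv => [] [] [].
have EL u v : agree X Y a b u -> u \in a' -> ~~ agree X Y a b v ->
    sideL X Y a v -> near u v.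
  move=> uE ua vE vL; have /andP[vX _] := vL.
  have [vY|vY] := boolP (all_near Y v); first exact: (agree_hub hp).
  have [vsY|vsY] := boolP (some_near Y v).
    by apply: (agree_mixed hp) => //; apply/andP.
  have ev : e h v.
    apply: near_e; first exact: L.
    by apply: contraNneq vsY => <-.
  apply: (hs u v (hEn u uE) ev); rewrite (halvesN hs ev ey0 (some_nearPn vsY y0Y)).
  by move: ua; rewrite a'E //; case: (s u) (s y0) => [] [].
have EK u v : agree X Y a b u -> u \notin a' -> ~~ agree X Y a b v ->
    sideK X Y a v -> near u v.
  move=> uE ua vE /and3P[vY vsX _].
  have [vX|vX] := boolP (all_near X v); first exact: (agree_hub hp).
  have uE' : agree Y X b a u by rewrite agree_sym.
  by apply: (agree_mixed (linked_sym hp) uE') => //; apply/andP.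
have NL u : ~~ agree X Y a b u -> sideL X Y a' u = sideL X Y a u.
  by move=> uE; rewrite /sideL a'N.
have NK u : ~~ agree X Y a b u -> sideK X Y a' u = sideK X Y a u.
  by move=> uE; rewrite /sideK a'N.
have agL u : agree X Y a b u -> sideL X Y a' u = (u \in a').
  by case/and3P=> uX uY _; rewrite /sideL uX uY.
have agK u : agree X Y a b u -> sideK X Y a' u = (u \notin a').
  by case/and3P=> uX uY _; rewrite /sideK uX uY all_some_near //; case: cXY.
exists a'; split.
- split=> //; split=> //; split=> u v.
    have [uE|uE] := boolP (agree X Y a b u); have [vE|vE] := boolP (agree X Y a b v).
    + by rewrite !agL // => ua va; apply: EE => //; rewrite ua va.
    + by rewrite (agL u) // (NL v) // => ua vL; apply: EL.
    + by rewrite (agL v) // (NL u) // => uL va; rewrite near_sym; apply: EL.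
    + by rewrite !NL //; apply: L.
  have [uE|uE] := boolP (agree X Y a b u); have [vE|vE] := boolP (agree X Y a b v).
  + by rewrite !agK // => ua va; apply: EE => //; rewrite (negbTE ua) (negbTE va).
  + by rewrite (agK u) // (NK v) // => ua vL; apply: EK.
  + by rewrite (agK v) // (NK u) // => uL va; rewrite near_sym; apply: EK.
  + by rewrite !NK //; apply: K.
- move=> u; have [//|uE] := boolP (agree X Y a b u).
  by rewrite {1}/agree a'N // -/(agree X Y a b u) (negbTE uE).
move=> u r uX uY ua rY rX hr; have [uE|uE] := boolP (agree X Y a b u).
  have er : e h r by apply: near_e => //; apply: contraNneq rX => <-.
  have nyx : ~~ near y0 x0 by [].
  apply: (hs u r (hEn u uE) er).
  rewrite (halvesN hs er (ex x0 x0X nyx) (some_nearPn rX x0X)).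
  rewrite -(halvesN hs ey0 (ex x0 x0X nyx) nyx).
  by move: ua; rewrite a'E // negbK => /eqP.
have rsX : ~~ all_near X r.
  by apply: contra rX; apply: all_some_near; case: cXY.
apply: L'; rewrite /sideL ?uX ?uY ?rY ?(negbTE rsX) //=.
have {}ua : u \notin a by rewrite -a'N.
by move: uE; rewrite /agree uX uY (negbTE ua) /=; case: (u \in b).
Qed.

Lemma all_nearU X v u : all_near (v |: X) u = near u v && all_near X u.
Proof.
apply/all_nearP/andP => [h|[uv /all_nearP h] x].
  split; first by apply: h; rewrite setU11.
  by apply/all_nearP => x xX; apply: h; rewrite inE xX orbT.
by rewrite !inE => /orP[/eqP->|/h].
Qed.

Lemma some_nearU X v u : some_near (v |: X) u = near u v || some_near X u.
Proof.
apply/some_nearP/orP => [[x]|[uv|/some_nearP[x xX ux]]].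
- rewrite !inE => /orP[/eqP->|xX ux]; first by left.
  by right; apply/some_nearP; exists x.
- by exists v; rewrite ?setU11.
- by exists x; rewrite // inE xX orbT.
Qed.

(** If [v] joins [X], the hubs not adjacent to [v] and the vertices beyond [Y]
adjacent to [v] become mixed for the enlarged [X].  Both kinds go to the side of
[Y], so they must be near to each other and to the hubs on that side; the last
hypothesis is the only part of this that is not already implied by the
colourings of the given pair. *)
Lemma add_mixed X Y a b v : linked X Y a b -> all_near X v -> mixed Y v ->
  (forall u r, all_near X u -> all_near Y u -> u \notin a ->
      all_near Y r -> ~~ some_near X r -> near v r -> near u r) ->
  linked (v |: X) Y a b.
Proof.
move=> hp vX /andP[vsY nvY] star.
have [[cXY mX [L K]] [cYX mY [L' K']]] := hp.
have [/some_nearP[y0 y0Y vy0]] := vsY.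
have [x0 x0X nyx0] := interlocked_far cYX y0Y.
have aX u : all_near X u -> some_near X u by apply: all_some_near; case: cXY.
have aY u : all_near Y u -> some_near Y u by apply: all_some_near; case: cYX.
have vL : sideL X Y a v by rewrite /sideL vX (negbTE nvY).
have evx0 : e v x0.
  apply: near_e; first exact: (all_nearP vX).
  by apply: contraNneq nyx0 => <-; rewrite near_sym.
have evy0 : e v y0.
  rewrite e_sym; apply: near_e_sep nyx0; first by rewrite near_sym.
  exact: (all_nearP vX).
have mX' u : mixed (v |: X) u -> all_near Y u.
  rewrite /mixed all_nearU some_nearU => /andP[suX naX].
  have [uX|uX] := boolP (some_near X u).
    have [aXu|aXu] := boolP (all_near X u); last by apply: mX; apply/andP.
    move: naX; rewrite aXu andbT; apply: contraNT => uY.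
    by apply: L; rewrite /sideL ?vX ?aXu ?(negbTE nvY) ?(negbTE uY).
  have uv : near u v by rewrite (negbTE uX) orbF in suX.
  have euv : e v u.
    by rewrite e_sym; apply: near_e => //; apply: contraNneq uX => ->; apply: aX.
  have [uY|uY] := boolP (some_near Y u).
    apply: contraNT uX => uaY; apply: aX; apply: mY; exact/andP.
  have ux0 := some_nearPn uX x0X; have uy0 := some_nearPn uY y0Y.
  by case/negP: uy0; apply: (no_claw euv evx0 evy0) => //; rewrite near_sym.
split; split.
- have [cX nX fX] := cXY; split.
  + move=> x y; rewrite !inE => /orP[/eqP->|xX] /orP[/eqP->|yX].
    * exact: nearxx.
    * exact: (all_nearP vX).
    * by rewrite near_sym (all_nearP vX).
    * exact: cX.
  + by apply/set0Pn; exists v; rewrite setU11.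
  + by move=> x; rewrite !inE => /orP[/eqP->|/fX //]; apply/andP.
- exact: mX'.
- split=> u w.
    rewrite /sideL !all_nearU -!andbA => /and3P[_ uX uY] /and3P[_ wX wY].
    by apply: L; rewrite /sideL ?uX ?wX.
  have cases z : sideK (v |: X) Y a z ->
      sideK X Y a z \/ [/\ all_near Y z, ~~ some_near X z & near z v].
    rewrite /sideK all_nearU some_nearU => /and3P[-> zs za] /=.
    have [zX|zX] := boolP (all_near X z).
      left; rewrite aX //=; move: za; rewrite zX andbT.
      have [zv|] := boolP (near z v) => //= nzv _.
      apply: contra nzv => za; apply: L => //.
      by rewrite /sideL zX za implybT.
    have [zsX|zsX] := boolP (some_near X z); first by left.
    by right; split=> //; rewrite (negbTE zsX) orbF in zs.
  have nall z : ~~ some_near X z -> ~~ all_near X z by apply: contra; apply: aX.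
  have KR z r : sideK X Y a z -> all_near Y r -> ~~ some_near X r -> near r v ->
      near z r.
    case/and3P=> zY zX za rY rX rv.
    have [aXz|aXz] := boolP (all_near X z).
      by apply: star; rewrite ?aXz // ?(near_sym v) //; move: za; rewrite aXz.
    apply: L'; rewrite /sideL ?zY ?rY ?(negbTE aXz) //.
    by rewrite (negbTE (nall _ rX)).
  case/cases=> [uK|[uY uX uv]] /cases[wK|[wY wX wv]].
  + exact: K.
  + exact: KR.
  + by rewrite near_sym; apply: KR.
  + by apply: L'; rewrite /sideL ?uY ?wY ?(negbTE (nall _ uX)) ?(negbTE (nall _ wX)).
- have [cY nY fY] := cYX; split=> // y yY; have /andP[ys ya] := fY y yY.
  by rewrite some_nearU ys orbT all_nearU (negbTE ya) andbF.
- move=> u /[dup] um /mY uX; rewrite all_nearU uX andbT.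
  have /andP[_ nuY] := um.
  by apply: L => //; rewrite /sideL uX (negbTE nuY).
- split=> u w.
    have old z : sideL Y (v |: X) b z -> sideL Y X b z.
      rewrite /sideL all_nearU => /andP[zY]; rewrite zY /=.
      have [zX|//] := boolP (all_near X z).
      have [zv|nzv] := boolP (near z v) => //= _.
      apply: contraNT nzv => zb; apply: K'.
        by rewrite /sideK zX zY aY.
      by rewrite /sideK vX vsY (negbTE nvY).
    by move=> /old uL /old wL; apply: L'.
  have old z : sideK Y (v |: X) b z -> sideK Y X b z.
    by rewrite /sideK all_nearU => /and3P[/andP[_ ->] -> ->].
  by move=> /old uL /old wL; apply: K'.
Qed.

Lemma linked_extend X Y a b v : linked X Y a b -> mixed Y v ->
  exists a', linked (v |: X) Y a' b.
Proof.
move=> hp vm; have [[cXY mX [L K]] [cYX mY [L' K']]] := hp.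
have vX := mY _ vm; have /andP[/some_nearP[y0 y0Y vy0] nvY] := vm.
have [||||a' [hp' _ star]] := @recolour X Y a b v y0 hp.
- by rewrite /sideL vX (negbTE nvY).
- by rewrite /agree (negbTE nvY) andbF.
- exact: y0Y.
- exact: vy0.
by exists a'; apply: add_mixed.
Qed.

Lemma linked_saturate X Y a b : linked X Y a b -> exists X' Y' a' b',
  [/\ linked X' Y' a' b', forall v, mixed Y' v -> v \in X'
     & forall v, mixed X' v -> v \in Y'].
Proof.
have [n] := ubnP (#|~: X| + #|~: Y|).
elim: n X Y a b => // n IHn X Y a b; rewrite ltnS => le_n hp.
have shrink (Z : {set V}) v : v \notin Z -> #|~: (v |: Z)| < #|~: Z|.
  move=> vZ; apply/proper_card/properP; split; first by rewrite setCS subsetUr.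
  by exists v; rewrite !inE ?eqxx.
have [/existsP[v /andP[vm vX]]|noY] := boolP [exists v, mixed Y v && (v \notin X)].
  have [a' hp'] := linked_extend hp vm.
  by apply: (IHn (v |: X) Y a' b) => //; apply: leq_trans le_n; rewrite ltn_add2r shrink.
have [/existsP[v /andP[vm vY]]|noX] := boolP [exists v, mixed X v && (v \notin Y)].
  have [b' hp'] := linked_extend (linked_sym hp) vm.
  apply: (IHn X (v |: Y) a b'); last exact: linked_sym.
  by apply: leq_trans le_n; rewrite ltn_add2l shrink.
exists X, Y, a, b; split=> // v vm.
  by move/existsPn/(_ v): noY; rewrite vm negbK.
by move/existsPn/(_ v): noX; rewrite vm negbK.
Qed.

(** A hub [u] placed with [X] by [a] and not with [Y] by [b] will be scheduled
together with [X]; for this, its neighbours on the side of [Y] and beyond [Y]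
must form a clique.  If they do not, recolouring by [u] makes [a] and [b] agree
on fewer hubs. *)
Lemma linked_balance X Y a b : linked X Y a b -> exists2 a', linked X Y a' b &
  forall u k r, all_near X u -> all_near Y u -> u \in a' -> u \notin b ->
    all_near X k -> all_near Y k -> k \notin a' -> k \notin b ->
    all_near Y r -> ~~ some_near X r -> near u r -> near k r.
Proof.
have [n] := ubnP #|[set u | agree X Y a b u]|.
elim: n a => // n IHn a; rewrite ltnS => le_n hp.
pose bad u k r := [&& all_near X u && all_near Y u, u \in a, u \notin b,
  all_near X k && all_near Y k, k \notin a, k \notin b, all_near Y r,
  ~~ some_near X r, near u r & ~~ near k r].
have [/existsP[u /existsP[k /existsP[r]]]|nobad] :=
  boolP [exists u, exists k, exists r, bad u k r]; last first.
  exists a => // u k r uX uY ua ub kX kY ka kb rY rX ur.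
  apply: contraNT nobad => nkr; apply/existsP; exists u; apply/existsP; exists k.
  apply/existsP; exists r; rewrite /bad uX uY ua ub kX kY ka kb rY rX ur /=.
  exact: nkr.
case/and5P=> /andP[uX uY] ua ub /andP[kX kY] /and5P[ka kb rY rX /andP[ur nkr]].
have [y0 y0Y] := set0Pn _ (linked_neq0r hp).
have [||||a' [hp' sub star]] := @recolour X Y a b u y0 hp.
- by rewrite /sideL uX ua implybT.
- by rewrite /agree ua (negbTE ub) !andbF.
- exact: y0Y.
- exact: (all_nearP uY).
apply: (IHn a') => //; apply: leq_trans le_n; apply: proper_card.
apply/properP; split; first by apply/subsetP=> v; rewrite !inE; apply: sub.
exists k; rewrite !inE; first by rewrite /agree kX kY (negbTE ka) (negbTE kb).
apply: contra nkr => /and3P[_ _ /eqP kab].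
by apply: star => //; rewrite kab.
Qed.

(** The set [H] of hubs that [a] places with [X] and [b] does not place with [Y]
is listed along with [X], and the remaining hubs are covered either by the clique
around [Y] or by the cliques leaving the members of [X]. *)
Lemma saturated_linked_slack X Y a b : linked X Y a b ->
  (forall v, mixed Y v -> v \in X) -> (forall v, mixed X v -> v \in Y) -> slack.
Proof.
case/linked_balance=> {}a hp bal satX satY.
have [[cXY mX [L K]] [cYX mY [L' K']]] := hp.
have [[cX nX fX] [cY nY fY]] := (cXY, cYX).
have aX u : all_near X u -> some_near X u by apply: all_some_near.
have aY u : all_near Y u -> some_near Y u by apply: all_some_near.
have inX x : x \in X -> all_near X x /\ ~~ all_near Y x.
  move=> xX; have /andP[_ ->] := fX x xX; split=> //.
  by apply/all_nearP=> z zX; apply: cX.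
have inY y : y \in Y -> all_near Y y /\ ~~ all_near X y.
  move=> yY; have /andP[_ ->] := fY y yY; split=> //.
  by apply/all_nearP=> z zY; apply: cY.
have XY x y : x \in X -> all_near Y y -> x != y.
  by move=> xX yY; apply: contraNneq (inX x xX).2 => ->.
have YX y x : y \in Y -> all_near X x -> y != x.
  by move=> yY xX; apply: contraNneq (inY y yY).2 => ->.
pose H := [set v | [&& all_near X v, all_near Y v, v \in a & v \notin b]].
pose LL := [set v | sideL X Y a v].
pose RR := [set v | all_near Y v && (all_near X v ==> (v \in a) && (v \in b))].
have RL v : v \in RR -> sideL Y X b v.
  rewrite inE /sideL => /andP[-> /=]; case: (all_near X v) => //=.
  by case/andP.
have outK v : some_near X v -> v \notin LL -> sideK X Y a v.
  rewrite inE /sideL /sideK => sv; rewrite sv /=.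
  have [vX|vX] := boolP (all_near X v) => /=; first by rewrite negb_imply andbC.
  by move=> _; rewrite (inY v (satY v _)).1 // /mixed sv.
have [x0 x0X] := set0Pn _ nX.
have /andP[/some_nearP[y1 y1Y xy1] /all_nearPn[y2 y2Y nxy2]] := fX x0 x0X.
apply: (@slack_pair LL RR (X :|: H) y1 y2).
- by move=> u v; rewrite !inE; apply: L.
- by move=> u v /RL uL /RL vL; apply: L'.
- apply/subsetP=> v; rewrite !inE /sideL => /orP[/inX[-> /negbTE->] //|].
  by case/and4P=> -> -> ->.
- move=> v; rewrite inE => /orP[vX|].
    have /andP[/some_nearP[y yY vy] _] := fX v vX.
    by exists y; apply: near_e => //; apply: XY => //; case: (inY y yY).
  rewrite inE => /and4P[vX vY _ _]; exists x0; apply: near_e.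
    exact: (all_nearP vX).
  by rewrite eq_sym; apply: XY.
- move=> u; rewrite inE => /orP[uX|].
    move=> v w; rewrite !inE -!/(v \notin _) => /andP[uv vL] /andP[uw wL].
    apply: K; apply: outK; rewrite ?inE //; apply/some_nearP; exists u => //.
      by rewrite near_sym e_near.
    by rewrite near_sym e_near.
  rewrite inE => /and4P[uX uY ua ub].
  have cases v : e u v -> ~~ sideL X Y a v ->
      sideK X Y a v \/ [/\ all_near Y v, ~~ some_near X v & near u v].
    move=> uv vL; have [vX|vX] := boolP (some_near X v).
      by left; apply: outK; rewrite ?inE.
    right; split=> //; last exact: e_near.
    have [vsY|vsY] := boolP (some_near Y v).
      apply: contraNT vX => vY; apply: aX; apply: (inX v (satX v _)).1.
      exact/andP.
    have ux0 : e u x0.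
      by apply: near_e; rewrite ?(all_nearP uX) // eq_sym; apply: XY.
    have uy2 : e u y2.
      by apply: near_e; rewrite ?(all_nearP uY) // eq_sym; apply: YX.
    have := no_claw ux0 uv uy2; rewrite (negbTE nxy2) near_sym => cl.
    have : false by apply: cl; [exact: some_nearPn vX x0X | exact: some_nearPn vsY y2Y].
    by [].
  have KR z r : sideK X Y a z -> all_near Y r -> ~~ some_near X r -> near u r ->
      near z r.
    case/and3P=> zY zX za rY rX ur.
    have rL : sideL Y X b r.
      by rewrite /sideL rY; have [/aX|//] := boolP (all_near X r); rewrite (negbTE rX).
    have [aXz|aXz] := boolP (all_near X z); last first.
      by apply: L' => //; rewrite /sideL zY (negbTE aXz).
    have [zb|zb] := boolP (z \in b); first by apply: L' => //; rewrite /sideL zY zb implybT.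
    by apply: (bal u z r) => //; move: za; rewrite aXz.
  move=> v w; rewrite !inE => /andP[uv vL] /andP[uw wL].
  have RLr r : all_near Y r -> ~~ some_near X r -> sideL Y X b r.
    by move=> rY rX; rewrite /sideL rY; have [/aX|//] := boolP (all_near X r); rewrite (negbTE rX).
  case: (cases v uv vL) (cases w uw wL) => [vK|[vY vX uv']] [wK|[wY wX uw']].
  + exact: K.
  + exact: KR.
  + by rewrite near_sym; apply: KR.
  + by apply: L'; apply: RLr.
- by apply: near_sep xy1 nxy2.
- rewrite !inE (negbTE (inY y1 y1Y).2) /= (inY y1 y1Y).1 /= !andbT orbF.
  by apply: contraNN (inY y1 y1Y).2 => /inX[].
- rewrite !inE (negbTE (inY y2 y2Y).2) /= (inY y2 y2Y).1 /= !andbT orbF.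
  by apply: contraNN (inY y2 y2Y).2 => /inX[].
move=> y v yy yv; have yY : y \in Y by move: yy; rewrite !inE => /orP[]/eqP->.
have [vX|nvX] := boolP (v \in X); first by constructor 1; rewrite inE vX.
have vsY : some_near Y v by apply/some_nearP; exists y => //; rewrite near_sym e_near.
have vY : all_near Y v by apply: contraNT nvX => vY; apply: satX; apply/andP.
have [vR|] := boolP (v \in RR); first by constructor 2.
rewrite inE vY /= negb_imply => /andP[vX nab].
have [va|va] := boolP (v \in a).
  by constructor 1; rewrite !inE vX vY va /=; move: nab; rewrite va => ->; rewrite orbT.
constructor 3; have /andP[/some_nearP[x xX yx] _] := fY y yY.
exists x; first by rewrite inE xX.
split.
- by apply: near_e; rewrite 1?near_sym //; apply: XY => //; case: (inY y yY).
- by apply: near_e; rewrite 1?near_sym ?(all_nearP vX) //; apply: XY.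
- by rewrite inE /sideL (negbTE (inY y yY).2).
- by rewrite inE /sideL vX vY (negbTE va).
Qed.

Lemma linked_slack X Y a b : linked X Y a b -> slack.
Proof.
case/linked_saturate=> X' [Y' [a' [b' [hp sX sY]]]].
exact: saturated_linked_slack hp sX sY.
Qed.

(** * Anchored squares *)

(** A square p p' q' q in the neighbourhood of its hub [w].  The last two fields
tie [w] to [q] in the neighbourhood of [p], and to [q'] in that of [p']: both
are nonadjacent to a common neighbour [l].  This singles out p p' and q q' as
the pair of opposite sides from which a homogeneous pair can be grown. *)
Record anchored_square w (t : V -> bool) p p' q q' : Prop := AnchoredSquare {
  as_halves : halves w t;
  as_wp : e w p; as_wp' : e w p'; as_wq : e w q; as_wq' : e w q';
  as_side : t p = t p';
  as_pp' : e p p'; as_qq' : e q q'; as_pq : e p q; as_p'q' : e p' q';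
  as_npq' : ~~ near p q'; as_np'q : ~~ near p' q;
  as_l : exists l, [/\ e p l, ~~ near w l & ~~ near l q];
  as_l' : exists l, [/\ e p' l, ~~ near w l & ~~ near l q'] }.

Lemma anchored_sym w t p p' q q' :
  anchored_square w t p p' q q' -> anchored_square w t p' p q' q.
Proof. by case=> *; split=> //; rewrite e_sym. Qed.

Lemma all_near2 x y v : all_near [set x; y] v = near v x && near v y.
Proof.
apply/all_nearP/andP => [h|[vx vy] z]; first by rewrite !h ?set21 ?set22.
by rewrite !inE => /orP[]/eqP->.
Qed.

Lemma some_near2 x y v : some_near [set x; y] v = near v x || near v y.
Proof.
apply/some_nearP/orP => [[z]|[vx|vy]].
- by rewrite !inE => /orP[]/eqP->; [left|right].
- by exists x; rewrite ?set21.
- by exists y; rewrite ?set22.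
Qed.

(** The neighbour [v] of [p] lies opposite to [p'], hence on the side of [w], so
it is a neighbour of [w]; there it lies opposite to [p'] again, hence on the
side of [q] and [q']. *)
Lemma anchored_mixed_fst w t p p' q q' v : anchored_square w t p p' q q' ->
  near v p -> ~~ near v p' -> near v q && near v q'.
Proof.
case=> ht wp wp' wq wq' side pp' qq' pq p'q' npq' np'q [l [pl nwl nlq]] _ vp nvp'.
have [s hs sq] := halves_true p q.
have sp' : s p' = false by rewrite (halvesN hs pp' pq np'q) sq.
have sl : s l = false by rewrite (halvesN hs pl pq nlq) sq.
have sw : s w by rewrite (halvesN hs _ pl nwl) ?sl // e_sym.
have pv : e p v.
  by apply: near_e; rewrite 1?near_sym //; apply: contraNneq nvp' => <-; apply: e_near.
have sv : s v by rewrite (halvesN hs pv pp' nvp') sp'.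
have wv : e w v.
  apply: near_e; first by apply: (hs w v); rewrite ?sw ?sv // e_sym.
  by apply: contraNneq nvp' => <-; apply: e_near.
have tv : t v = ~~ t p' := halvesN ht wv wp' nvp'.
apply/andP; split; apply: contraT => nv.
  by have := halvesN hs pv pq nv; rewrite sv sq.
have := halvesN ht wv wq' nv; rewrite tv -side.
by rewrite (halvesN ht wp wq' npq') negbK; case: (t q').
Qed.

Lemma anchored_mixed_snd w t p p' q q' v : anchored_square w t p p' q q' ->
  near v q -> ~~ near v q' -> near v p && near v p'.
Proof.
move=> sq vq nvq'; have [ht wp wp' wq wq' side pp' qq' pq p'q' npq' np'q _ _] := sq.
have qv : e q v.
  by apply: near_e; rewrite 1?near_sym //; apply: contraNneq nvq' => <-; apply: e_near.
have vp : near v p.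
  have [s hs sqq] := halves_true q q'.
  apply: (hs v p); rewrite // 1?e_sym //.
  by rewrite (halvesN hs qv qq' nvq') (halvesN hs _ qq' npq') // e_sym.
rewrite vp /=; apply: contraT => nvp'.
by have := anchored_mixed_fst sq vp nvp'; rewrite (negbTE nvq') andbF.
Qed.

(** The colourings are read off the neighbourhoods of the four corners.  The
neighbourhoods of [p] and [p'] colour every hub; where these two colours agree
they are used for [a], and where they differ the hub is adjacent to [w], by the
anchors, and takes its colour from [t].  In the same way [b] uses the common
colour given by [q] and [q'], and the opposite of [a] where these differ. *)
Lemma anchored_linked w t p p' q q' : anchored_square w t p p' q q' ->
  exists a b, linked [set p; p'] [set q; q'] a b.
Proof.
move=> asq; have asq' := anchored_sym asq.
have [ht wp wp' wq wq' side pp' qq' pq p'q' npq' np'q] := asq.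
move=> [l [pl nwl nlq]] [l' [pl' nwl' nlq']].
have [nq'p nqp'] : ~~ near q' p /\ ~~ near q p' by split; rewrite near_sym.
have [s hs sq] := halves_true p q.
have [s' hs' sq'] := halves_true p' q'.
have [r hr rq'] := halves_true q q'.
have [r' hr' rq] := halves_true q' q.
have sp' : s p' = false by rewrite (halvesN hs pp' pq np'q) sq.
have s'p : s' p = false by rewrite (halvesN hs' _ p'q' npq') ?sq' // e_sym.
have rp : r p = false by rewrite (halvesN hr _ qq' npq') ?rq' // e_sym.
have r'p' : r' p' = false by rewrite (halvesN hr' _ _ np'q) ?rq // e_sym.
have sl : s l = false by rewrite (halvesN hs pl pq nlq) sq.
have sw : s w by rewrite (halvesN hs _ pl nwl) ?sl // e_sym.
have s'l' : s' l' = false by rewrite (halvesN hs' pl' p'q' nlq') sq'.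
have s'w : s' w by rewrite (halvesN hs' _ pl' nwl') ?s'l' // e_sym.
have tq : t q = ~~ t p by rewrite side; exact: (halvesN ht wq wp' nqp').
have tq' : t q' = ~~ t p := halvesN ht wq' wp nq'p.
pose X := [set p; p']; pose Y := [set q; q'].
have XE v : all_near X v = near v p && near v p' by apply: all_near2.
have YE v : all_near Y v = near v q && near v q' by apply: all_near2.
have XS v : some_near X v = near v p || near v p' by apply: some_near2.
have YS v : some_near Y v = near v q || near v q' by apply: some_near2.
pose a := [set u | if s u == s' u then ~~ s u else t u == t p].
pose b := [set u | if r u == r' u then r u else u \notin a].
exists a, b; rewrite -/X -/Y.
have eX v : all_near X v -> v \notin X -> e p v /\ e p' v.
  rewrite XE !inE negb_or => /andP[vp vp'] /andP[np np'].
  by split; rewrite e_sym near_e.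
have eY v : all_near Y v -> v \notin Y -> e q v /\ e q' v.
  rewrite YE !inE negb_or => /andP[vp vp'] /andP[np np'].
  by split; rewrite e_sym near_e.
have trivX u v : all_near X v -> u \in X -> near u v.
  by move=> /all_nearP vX uX; rewrite near_sym vX.
have trivY u v : all_near Y v -> u \in Y -> near u v.
  by move=> /all_nearP vX uX; rewrite near_sym vX.
(* On the side of X the colours are those of p' and p; if they differ, u is
   adjacent to w and has the colour of p there. *)
have sideLE u : sideL X Y a u -> u \notin X ->
    (s u = false /\ s' u = false) \/ [/\ s u != s' u, e w u & t u = t p].
  move=> /andP[uX ua] nX; have [pu p'u] := eX u uX nX.
  have wu : s u || s' u -> ~~ (s u && s' u) -> e w u.
    move=> su nsu; apply: near_e.
      by case/orP: su => su; [apply: (hs w u)|apply: (hs' w u)];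
        rewrite ?sw ?s'w ?su // e_sym.
    by apply: contraNneq nsu => <-; rewrite sw s'w.
  have [uq|nuq] := boolP (near u q); last first.
    have su : s u = false by rewrite (halvesN hs pu pq nuq) sq.
    case s'u: (s' u); last by left.
    have {}wu : e w u by apply: wu; rewrite su s'u.
    by right; split; rewrite // ?su // (halvesN ht wu wq nuq) tq negbK.
  have [uq'|nuq'] := boolP (near u q'); last first.
    have su : s' u = false by rewrite (halvesN hs' p'u p'q' nuq') sq'.
    case s'u: (s u); last by left.
    have {}wu : e w u by apply: wu; rewrite su s'u.
    by right; split; rewrite // ?su // (halvesN ht wu wq' nuq') tq' negbK.
  move: ua; rewrite YE uq uq' /= inE; case: (boolP (s u == s' u)) => [/eqP su|su].
    by rewrite su => /negbTE ->; left.
  move/eqP=> tu; right; split=> //; apply: wu.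
    by case: (s u) (s' u) su => [] [].
  by case: (s u) (s' u) su => [] [].
have colL u v : sideL X Y a u -> sideL X Y a v -> near u v.
  move=> uL vL; have [/andP[uX _] /andP[vX _]] := (uL, vL).
  have [uX'|nuX] := boolP (u \in X); first exact: trivX.
  have [vX'|nvX] := boolP (v \in X); first by rewrite near_sym; apply: trivX.
  have [[pu p'u] [pv p'v]] := (eX u uX nuX, eX v vX nvX).
  apply: contraT => nuv.
  have suv := halvesN hs pu pv nuv; have s'uv := halvesN hs' p'u p'v nuv.
  case: (sideLE u uL nuX) (sideLE v vL nvX) => [[su s'u]|[su wu tu]] [[sv s'v]|[sv wv tv]].
  - by move: suv; rewrite su sv.
  - by move: sv suv s'uv; rewrite su s'u; case: (s v) (s' v) => [] [].
  - by move: su suv s'uv; rewrite sv s'v; case: (s u) (s' u) => [] [].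
  - by case/negP: nuv; apply: (ht u v); rewrite // tu tv.
(* On the side of Y they are those of w, or u is adjacent to w and has the
   colour of q there. *)
have sideKE u : sideK X Y a u -> u \notin Y ->
    [\/ [/\ all_near X u, e p u, e p' u, s u & s' u],
        [/\ all_near X u, e p u & e p' u] /\ [/\ s u != s' u, e w u & t u = ~~ t p]
      | [/\ (e p u /\ s u) \/ (e p' u /\ s' u), e w u & t u = ~~ t p]].
  move=> /and3P[uY usX ua] nY.
  have uXp : u != p /\ u != p'.
    by split; apply: contraTneq uY => ->; rewrite YE ?(negbTE npq') ?(negbTE np'q) ?andbF.
  have [pu p'u] : (near u p -> e p u) /\ (near u p' -> e p' u).
    by split=> h; rewrite e_sym near_e //; case: uXp.
  have [up|nup] := boolP (near u p); have [up'|nup'] := boolP (near u p').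
  - have uX : all_near X u by rewrite XE up up'.
    move: ua; rewrite uX /= inE; case: (boolP (s u == s' u)) => [/eqP su|su].
      rewrite su negbK => s'u.
      by constructor 1; split=> //; [apply: pu|apply: p'u].
    move=> tu; constructor 2; split; first by split=> //; [apply: pu|apply: p'u].
    split=> //; last by case: (t u) (t p) tu => [] [].
    have: s u || s' u by case: (s u) (s' u) su => [] [].
    move=> su'; apply: near_e.
      by case/orP: su' => su'; [apply: (hs w u)|apply: (hs' w u)];
        rewrite ?sw ?s'w ?su' ?pu ?p'u // e_sym.
    by apply: contraNneq su => <-; rewrite sw s'w.
  - have su : s u by rewrite (halvesN hs (pu up) pp' nup') sp'.
    have wu' : e w u.
      apply: near_e; first by apply: (hs w u); rewrite ?sw ?su ?pu // e_sym.
      by apply: contraNneq nup' => <-; apply: e_near.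
    constructor 3; split=> //; first by left; split=> //; apply: pu.
    by rewrite (halvesN ht wu' wp' nup') side.
  - have su : s' u by rewrite (halvesN hs' (p'u up') _ nup) ?s'p // e_sym.
    have wu' : e w u.
      apply: near_e; first by apply: (hs' w u); rewrite ?s'w ?su ?p'u // e_sym.
      by apply: contraNneq nup => <-; apply: e_near.
    constructor 3; split=> //; first by right; split=> //; apply: p'u.
    by rewrite (halvesN ht wu' wp nup).
  - by move: usX; rewrite XS (negbTE nup) (negbTE nup').
have colK u v : sideK X Y a u -> sideK X Y a v -> near u v.
  move=> uK vK; have [/and3P[uY _ _] /and3P[vY _ _]] := (uK, vK).
  have [uY'|nuY] := boolP (u \in Y); first exact: trivY.
  have [vY'|nvY] := boolP (v \in Y); first by rewrite near_sym; apply: trivY.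
  apply: contraT => nuv.
  have bb x y : s x != s' x -> s y -> s' y -> e p x -> e p' x -> e p y -> e p' y ->
      near x y.
    move=> sx sy s'y px p'x py p'y; case sx': (s x).
      by apply: (hs x y); rewrite ?sy ?sx'.
    by apply: (hs' x y); rewrite ?s'y //; move: sx; rewrite sx'; case: (s' x).
  case: (sideKE u uK nuY) (sideKE v vK nvY) =>
    [[uX pu p'u su s'u]|[[uX pu p'u] [su wu tu]]|[su wu tu]]
    [[vX pv p'v sv s'v]|[[vX pv p'v] [sv wv tv]]|[sv wv tv]];
    try by case/negP: nuv; apply: (ht u v); rewrite // tu tv.
  - by case/negP: nuv; apply: (hs u v); rewrite ?su ?sv.
  - by case/negP: nuv; rewrite near_sym; apply: bb.
  - by case/negP: nuv; case: sv => -[xv sv]; [apply: (hs u v)|apply: (hs' u v)];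
      rewrite // sv ?su ?s'u.
  - by case/negP: nuv; apply: bb.
  - by case/negP: nuv; case: su => -[xv su]; [apply: (hs u v)|apply: (hs' u v)];
      rewrite // su ?sv ?s'v.
have sideLE' u : sideL Y X b u -> u \notin Y ->
    (r u /\ r' u) \/ (r u != r' u /\ sideK X Y a u).
  move=> /andP[uY ub] nY; have [qu q'u] := eY u uY nY.
  case: (boolP (r u == r' u)) => [/eqP ru|ru].
    left; rewrite -ru; suff -> : r u by [].
    have [uX|] := boolP (all_near X u); first by move: ub; rewrite uX /= inE ru eqxx.
    rewrite XE; have [up|nup] := boolP (near u p) => /= nup'.
      by rewrite ru (halvesN hr' q'u _ nup') ?r'p' // e_sym.
    by rewrite (halvesN hr qu _ nup) ?rp // e_sym.
  right; split=> //; rewrite /sideK uY /=.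
  have [uX|nuX] := boolP (all_near X u).
    rewrite all_some_near //=; first by move: ub; rewrite uX /= inE (negbTE ru).
    by apply/set0Pn; exists p; rewrite set21.
  rewrite /= andbT XS; apply: contraT; rewrite negb_or => /andP[nup nup'].
  by move: ru; rewrite (halvesN hr qu _ nup) ?(halvesN hr' q'u _ nup') ?rp ?r'p' // e_sym.
have colL' u v : sideL Y X b u -> sideL Y X b v -> near u v.
  move=> uL vL; have [/andP[uY _] /andP[vY _]] := (uL, vL).
  have [uY'|nuY] := boolP (u \in Y); first exact: trivY.
  have [vY'|nvY] := boolP (v \in Y); first by rewrite near_sym; apply: trivY.
  have [[qu q'u] [qv q'v]] := (eY u uY nuY, eY v vY nvY).
  apply: contraT => nuv.
  have ruv := halvesN hr qu qv nuv; have r'uv := halvesN hr' q'u q'v nuv.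
  case: (sideLE' u uL nuY) (sideLE' v vL nvY) => [[ru r'u]|[ru uK]] [[rv r'v]|[rv vK]].
  - by move: ruv; rewrite ru rv.
  - by move: rv ruv r'uv; rewrite ru r'u; case: (r v) (r' v) => [] [].
  - by move: ru ruv r'uv; rewrite rv r'v; case: (r u) (r' u) => [] [].
  - by case/negP: nuv; apply: colK.
have sideKE' u : sideK Y X b u -> u \notin X ->
    [\/ [/\ e q u, e q' u, r u = false & r' u = false],
        [/\ e q u, e q' u, r u != r' u & sideL X Y a u]
      | sideL X Y a u /\ ((e q u /\ r u = false) \/ (e q' u /\ r' u = false))].
  move=> /and3P[uX usY ub] nX.
  have uYq : u != q /\ u != q'.
    by split; apply: contraTneq uX => ->; rewrite XE ?(negbTE nq'p) ?(negbTE nqp') ?andbF.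
  have [qu q'u] : (near u q -> e q u) /\ (near u q' -> e q' u).
    by split=> h; rewrite e_sym near_e //; case: uYq.
  have [uq|nuq] := boolP (near u q); have [uq'|nuq'] := boolP (near u q').
  - have uY : all_near Y u by rewrite YE uq uq'.
    move: ub; rewrite uY /= inE; case: (boolP (r u == r' u)) => [/eqP ru|ru].
      by move/negbTE => ru'; constructor 1; split; rewrite -?ru ?qu ?q'u.
    rewrite negbK => ua; constructor 2; split; rewrite ?qu ?q'u //.
    by rewrite /sideL uX ua implybT.
  - constructor 3; split; first by rewrite /sideL uX YE (negbTE nuq') andbF.
    by left; split; rewrite ?qu // (halvesN hr (qu uq) qq' nuq') rq'.
  - constructor 3; split; first by rewrite /sideL uX YE (negbTE nuq).
    by right; split; rewrite ?q'u // (halvesN hr' (q'u uq') _ nuq) ?rq // e_sym.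
  - by move: usY; rewrite YS (negbTE nuq) (negbTE nuq').
have colK' u v : sideK Y X b u -> sideK Y X b v -> near u v.
  move=> uK vK; have [/and3P[uX _ _] /and3P[vX _ _]] := (uK, vK).
  have [uX'|nuX] := boolP (u \in X); first exact: trivX.
  have [vX'|nvX] := boolP (v \in X); first by rewrite near_sym; apply: trivX.
  apply: contraT => nuv.
  have bb x y : r x != r' x -> r y = false -> r' y = false ->
      e q x -> e q' x -> e q y -> e q' y -> near x y.
    move=> rx ry r'y qx q'x qy q'y; case rx': (r x); last first.
      by apply: (hr x y); rewrite ?ry ?rx'.
    by apply: (hr' x y); rewrite ?r'y //; move: rx; rewrite rx'; case: (r' x).
  case: (sideKE' u uK nuX) (sideKE' v vK nvX) =>
    [[qu q'u ru r'u]|[qu q'u ru uL]|[uL ru]] [[qv q'v rv r'v]|[qv q'v rv vL]|[vL rv]];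
    try by case/negP: nuv; apply: colL.
  - by case/negP: nuv; apply: (hr u v); rewrite ?ru ?rv.
  - by case/negP: nuv; rewrite near_sym; apply: bb.
  - by case/negP: nuv; case: rv => -[xv rv]; [apply: (hr u v)|apply: (hr' u v)];
      rewrite // rv ?ru ?r'u.
  - by case/negP: nuv; apply: bb.
  - by case/negP: nuv; case: ru => -[xv ru]; [apply: (hr u v)|apply: (hr' u v)];
      rewrite // ru ?rv ?r'v.
split; split.
- split.
  + by move=> x y; rewrite !inE => /orP[]/eqP-> /orP[]/eqP->;
      rewrite ?nearxx // /near 1?e_sym ?pp' ?orbT // e_sym pp' orbT.
  + by apply/set0Pn; exists p; rewrite set21.
  + by move=> x; rewrite !inE => /orP[]/eqP->; rewrite YE YS ?(negbTE npq') ?(negbTE np'q)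
      ?(e_near pq) ?(e_near p'q') ?andbF ?orbT.
- move=> v; rewrite /mixed XE XS YE => /andP[/orP[vp|vp']].
    by rewrite vp /= => nvp'; apply: anchored_mixed_fst asq vp nvp'.
  by rewrite vp' andbT => nvp; rewrite andbC; apply: anchored_mixed_fst asq' vp' nvp.
- by split.
- split.
  + by move=> x y; rewrite !inE => /orP[]/eqP-> /orP[]/eqP->;
      rewrite ?nearxx // /near 1?e_sym ?qq' ?orbT // e_sym qq' orbT.
  + by apply/set0Pn; exists q; rewrite set21.
  + by move=> x; rewrite !inE => /orP[]/eqP->; rewrite XE XS ?(negbTE nq'p) ?(negbTE nqp')
      ?(near_sym q p) ?(near_sym q' p') ?(e_near pq) ?(e_near p'q') ?andbF ?orbT.
- move=> v; rewrite /mixed XE YS YE => /andP[/orP[vq|vq']].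
    by rewrite vq /= => nvq'; apply: anchored_mixed_snd asq vq nvq'.
  by rewrite vq' andbT => nvq; rewrite andbC; apply: anchored_mixed_snd asq' vq' nvq.
- by split.
Qed.

Lemma anchored_slack w t p p' q q' : anchored_square w t p p' q q' -> slack.
Proof. by case/anchored_linked=> a [b]; apply: linked_slack. Qed.

(** * An unshared end yields an anchored square *)

(** Let [Z p] be the neighbours of [p] beyond [w], and [D p] the neighbours of
[p] and [w] outside [A] that are not near to all of [Z p].  Each [D p] is
nonempty.  Take [p] with [Z p] largest and then [D p] smallest, and let [q] be
in [D p].  As [A] is maximal, some [p'] in [A] is not near to [q], which forces
[Z p'] to equal [Z p]; by minimality [D p'] is not a proper subset of [D p],
so it has a member not near to [p]. *)
Lemma stuck_anchored w (A : {set V}) p0 : clq A -> w \in A ->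
  (forall v, all_near A v -> v \in A) -> clq [set v | e w v & v \notin A] ->
  p0 \in A -> p0 != w ->
  (forall p, p \in A -> p != w ->
     exists c d, [/\ e p c, e p d, c \notin A, d \notin A & ~~ near c d]) ->
  exists t p p' q q', anchored_square w t p p' q q'.
Proof.
move=> cA wA maxA cB p0A p0w badA.
pose Z p := [set l | e p l && ~~ near w l].
pose D p := [set q | [&& e w q, q \notin A, e p q & [exists l in Z p, ~~ near l q]]].
have Aw p : p \in A -> p != w -> e w p.
  by move=> pA pw; apply: near_e; rewrite ?cA // eq_sym.
have D0 p : p \in A -> p != w -> exists q, q \in D p.
  move=> pA pw; have [c [d [pc pd cA' dA ncd]]] := badA p pA pw.
  have sep x : x \notin A -> w != x by move=> xA; apply: contraNneq xA => <-.
  have pew : e p w by rewrite e_sym Aw.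
  have [wc|wc] := boolP (near w c); have [wd|wd] := boolP (near w d).
  - by case/negP: ncd; apply: cB; rewrite inE ?cA' ?dA andbT near_e ?sep.
  - exists c; rewrite inE pc cA' near_e ?sep //=; apply/exists_inP; exists d.
      by rewrite inE pd.
    by rewrite near_sym.
  - exists d; rewrite inE pd dA near_e ?sep //=; apply/exists_inP; exists c => //.
    by rewrite inE pc.
  - by case/negP: ncd; apply: (no_claw pc pew pd) => //; rewrite near_sym.
pose P p := (p \in A) && (p != w).
have Pp0 : P p0 by apply/andP.
case: (arg_maxnP (fun p => #|Z p|) Pp0) => p1 Pp1 maxZ.
pose P2 p := P p && (#|Z p| == #|Z p1|).
have P2p1 : P2 p1 by rewrite /P2 Pp1 eqxx.
case: (arg_minnP (fun p => #|D p|) P2p1) => p /andP[/andP[pA pw] /eqP Zp] minD.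
have [q qD] := D0 p pA pw.
move: (qD); rewrite inE => /and4P[wq qA pq /exists_inP[l]].
rewrite inE => /andP[pl nwl] nlq.
have [p' p'A nqp'] : exists2 p', p' \in A & ~~ near q p'.
  by apply: all_nearPn; apply: contra qA; apply: maxA.
have p'w : p' != w by apply: contraNneq nqp' => ->; rewrite near_sym e_near.
have pp' : e p p'.
  by apply: near_e; rewrite ?cA //; apply: contraNneq nqp' => <-; rewrite near_sym e_near.
have [s hs sw] := halves_true p w.
have epw : e p w by rewrite e_sym Aw.
have sl : s l = false by rewrite (halvesN hs pl epw) ?sw // near_sym.
have sq : s q by rewrite (halvesN hs pq pl) ?sl // near_sym.
have sp' : s p' = false by rewrite (halvesN hs pp' pq) ?sq // near_sym.
(* Both p' and the members of Z p lie opposite to w, which is on the side of q. *)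
have sub : Z p \subset Z p'.
  apply/subsetP=> z; rewrite !inE => /andP[pz nwz]; rewrite nwz andbT.
  have sz : s z = false by rewrite (halvesN hs pz epw) ?sw // near_sym.
  apply: near_e; first by apply: (hs p' z); rewrite // sz sp'.
  by apply: contraNneq nwz => <-; rewrite e_near ?Aw.
have ZE : Z p = Z p'.
  apply/eqP; rewrite eqEcard sub Zp; apply: maxZ.
  by rewrite /P p'A p'w.
(* A member of D p' not near to p completes the square; else D p' is a proper
   subset of D p, as it misses q. *)
have [/exists_inP[q' q'D npq']|noq] := boolP [exists q' in D p', ~~ near p q'].
  move: (q'D); rewrite inE => /and4P[wq' q'A p'q' /exists_inP[l']].
  rewrite inE => /andP[p'l' nwl'] nl'q'.
  have [wp wp'] := (Aw p pA pw, Aw p' p'A p'w).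
  exists (fun v => v \in A), p, p', q, q'; split=> //.
  - move=> x y wx wy xy; have [xA|xA] := boolP (x \in A).
      by apply: cA; rewrite -?xy.
    by apply: cB; rewrite inE ?wx ?wy -?xy.
  - by rewrite pA p'A.
  - apply: near_e; first by apply: cB; rewrite inE ?wq ?wq'.
    by apply: contraNneq npq' => <-; apply: e_near.
  - by rewrite near_sym.
  - by exists l.
  - by exists l'.
have: #|D p'| < #|D p|.
  apply/proper_card/properP; split.
    apply/subsetP=> x xD; move: (xD); rewrite !inE -ZE => /and4P[-> xA _ ->].
    rewrite xA andbT /= near_e //.
      by move/exists_inPn/(_ x xD): noq; rewrite negbK.
    by apply: contraNneq xA => <-.
  exists q => //; rewrite inE; apply: contra nqp' => /and4P[_ _ p'q _].
  by rewrite near_sym e_near.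
by rewrite ltnNge minD // /P2 /P p'A p'w -ZE Zp eqxx.
Qed.

(** * Vertices with essentially different splittings *)
Section NoSlack.
Hypothesis noslack : ~ slack.

Lemma no_anchored w t p p' q q' : ~ anchored_square w t p p' q q'.
Proof. by move/anchored_slack. Qed.

Definition beyond u v := [set l | e v l && ~~ near u l].

(** Otherwise the two missing inclusions would provide the anchors. *)
Lemma square_beyond u t p p' q q' : halves u t ->
  e u p -> e u p' -> e u q -> e u q' -> t p = t p' ->
  e p p' -> e q q' -> e p q -> e p' q' -> ~~ near p q' -> ~~ near p' q ->
  (beyond u p \subset beyond u q) || (beyond u p' \subset beyond u q').
Proof.
move=> ht up up' uq uq' tp pp' qq' pq p'q' npq' np'q; apply: contraT.
rewrite negb_or => /andP[/subsetPn[l lp lq] /subsetPn[l' lp' lq']].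
case: (@no_anchored u t p p' q q'); split=> //.
- move: lp lq; rewrite !inE => /andP[pl ul]; rewrite ul andbT => ql'.
  exists l; split=> //; apply: contra ql' => nlq; rewrite e_sym near_e //.
  by apply: contraNneq ul => ->; apply: e_near.
- move: lp' lq'; rewrite !inE => /andP[pl ul]; rewrite ul andbT => ql'.
  exists l'; split=> //; apply: contra ql' => nlq; rewrite e_sym near_e //.
  by apply: contraNneq ul => ->; apply: e_near.
Qed.

Lemma beyond_claw u v x y : e v x -> e v y -> e u x -> e u y -> ~~ near x y ->
  beyond u v \subset beyond u x :|: beyond u y.
Proof.
move=> vx vy ux uy nxy; apply/subsetP=> l; rewrite !inE => /andP[vl ul].
rewrite ul !andbT; apply: contraT; rewrite negb_or => /andP[xl yl].
have sep z : e u z -> z != l by move=> uz; apply: contraNneq ul => <-; apply: e_near.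
case/negP: nxy; apply: (no_claw vx vl vy).
  by apply: contra xl => xl; apply: near_e; rewrite ?sep.
by apply: contra yl => yl; apply: near_e; rewrite 1?near_sym ?sep.
Qed.

(** Two colourings of the neighbourhood of [u] divide it into the part where
they agree and the part where they differ.  Nonadjacent vertices lie in the same
part, so the two parts are completely joined. *)
Section Flexible.
Variables (u : V) (t1 t2 : V -> bool).
Hypotheses (h1 : halves u t1) (h2 : halves u t2).

Definition nonedge x y := [&& e u x, e u y & ~~ near x y].

Lemma nonedge_flip x y : nonedge x y -> t1 y = ~~ t1 x /\ t2 y = ~~ t2 x.
Proof.
case/and3P=> ux uy nxy; split; [apply: halvesN h1 uy ux _|apply: halvesN h2 uy ux _];
  by rewrite near_sym.
Qed.

Lemma nonedge_sym x y : nonedge x y = nonedge y x.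
Proof. by rewrite /nonedge near_sym andbCA. Qed.

Lemma cross_near x y : e u x -> e u y -> t1 x = t2 x -> t1 y != t2 y -> near x y.
Proof.
move=> ux uy tx; apply: contraNT => nxy; move: tx.
by rewrite (halvesN h1 ux uy nxy) (halvesN h2 ux uy nxy) => /negb_inj ->.
Qed.

Lemma cross_e x y : e u x -> e u y -> t1 x = t2 x -> t1 y != t2 y -> e x y.
Proof.
move=> ux uy tx ty; apply: near_e; first exact: cross_near.
by apply: contraNneq ty => <-; apply/eqP.
Qed.

Lemma beyond_union x1 y1 x2 y2 : nonedge x1 y1 -> nonedge x2 y2 ->
  t1 x1 = t2 x1 -> t1 x2 != t2 x2 ->
  beyond u x1 :|: beyond u y1 = beyond u x2 :|: beyond u y2.
Proof.
move=> n1 n2 a1 d2; have [f1 f2] := (nonedge_flip n1, nonedge_flip n2).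
case/and3P: (n1) => ux1 uy1 nxy1; case/and3P: (n2) => ux2 uy2 nxy2.
have b1 : t1 y1 = t2 y1 by rewrite f1.1 f1.2 a1.
have e2 : t1 y2 != t2 y2 by rewrite f2.1 f2.2; case: (t1 x2) (t2 x2) d2 => [] [].
have [x1x2 x1y2] := (cross_e ux1 ux2 a1 d2, cross_e ux1 uy2 a1 e2).
have [y1x2 y1y2] := (cross_e uy1 ux2 b1 d2, cross_e uy1 uy2 b1 e2).
apply/eqP; rewrite eqEsubset !subUset.
by apply/andP; split; apply/andP; split; apply: beyond_claw => //; rewrite e_sym.
Qed.

(** A nonadjacent pair from each part makes a square around [u], which either
colouring splits into two cliques.  Applying [square_beyond] to the four sides
gives four inclusions, and each choice among their alternatives makes one of
the two pairs see the same vertices beyond [u]. *)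
Lemma beyond_equal x1 y1 x2 y2 : nonedge x1 y1 -> nonedge x2 y2 ->
  t1 x1 = t2 x1 -> t1 x2 != t2 x2 ->
  beyond u x1 = beyond u y1 \/ beyond u x2 = beyond u y2.
Proof.
wlog tx : x2 y2 / t1 x1 = t1 x2.
  move=> wl n1 n2 a1 d2; have [tx|tx] := eqVneq (t1 x1) (t1 x2); first exact: wl.
  have [f1 f2] := nonedge_flip n2.
  case: (wl y2 x2 _ n1 _ a1); first by rewrite f1; case: (t1 x1) (t1 x2) tx => [] [].
  - by rewrite nonedge_sym.
  - by rewrite f1 f2; case: (t1 x2) (t2 x2) d2 => [] [].
  - by left.
  - by move=> ->; right.
move=> n1 n2 a1 d2; have [[f1 f1'] [f2 f2']] := (nonedge_flip n1, nonedge_flip n2).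
case/and3P: (n1) => ux1 uy1 nxy1; case/and3P: (n2) => ux2 uy2 nxy2.
have b1 : t1 y1 = t2 y1 by rewrite f1 f1' a1.
have d2' : t1 y2 != t2 y2 by rewrite f2 f2'; case: (t1 x2) (t2 x2) d2 => [] [].
have t2x2 : t2 x2 = ~~ t1 x2 by case: (t1 x2) (t2 x2) d2 => [] [].
have nyx1 : ~~ near y1 x1 by rewrite near_sym.
have nyx2 : ~~ near y2 x2 by rewrite near_sym.
have [x1x2 x1y2] := (cross_e ux1 ux2 a1 d2, cross_e ux1 uy2 a1 d2').
have [y1x2 y1y2] := (cross_e uy1 ux2 b1 d2, cross_e uy1 uy2 b1 d2').
have [x2x1 y2x1] : e x2 x1 /\ e y2 x1 by split; rewrite e_sym.
have [x2y1 y2y1] : e x2 y1 /\ e y2 y1 by split; rewrite e_sym.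
have U := beyond_union n1 n2 a1 d2.
have S1 : (beyond u x1 \subset beyond u y2) || (beyond u x2 \subset beyond u y1).
  by apply: (square_beyond h1).
have S2 : (beyond u y1 \subset beyond u x2) || (beyond u y2 \subset beyond u x1).
  by apply: (square_beyond h1) => //; rewrite f1 f2 tx.
have S3 : (beyond u x1 \subset beyond u x2) || (beyond u y2 \subset beyond u y1).
  by apply: (square_beyond h2) => //; rewrite -a1 f2' t2x2 tx negbK.
have S4 : (beyond u y1 \subset beyond u y2) || (beyond u x2 \subset beyond u x1).
  by apply: (square_beyond h2) => //; rewrite -b1 f1 t2x2 tx.
have U' z : (z \in beyond u x1) || (z \in beyond u y1) =
            (z \in beyond u x2) || (z \in beyond u y2) by rewrite -!in_setU U.
have imp (A B : {set V}) : A \subset B -> forall z, (z \in A) ==> (z \in B).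
  by move=> /subsetP sAB z; apply/implyP; apply: sAB.
case/orP: S1 => /imp S1; case/orP: S2 => /imp S2; case/orP: S3 => /imp S3;
case/orP: S4 => /imp S4;
(by left; apply/setP=> z; move: (U' z) (S1 z) (S2 z) (S3 z) (S4 z);
  case: (z \in beyond u x1); case: (z \in beyond u y1);
  case: (z \in beyond u x2); case: (z \in beyond u y2)) ||
(by right; apply/setP=> z; move: (U' z) (S1 z) (S2 z) (S3 z) (S4 z);
  case: (z \in beyond u x1); case: (z \in beyond u y1);
  case: (z \in beyond u x2); case: (z \in beyond u y2)).
Qed.

(** If all nonadjacent pairs of the second part see the same set [Z] beyond [u],
then the closed neighbourhood of [u] together with [Z] is a component.  It is
covered by two cliques: the members [C] of the second part with a nonneighbour
there are near to everything else in the component and are coloured by [t1],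
while the rest is in the neighbourhood of any one of them. *)
Lemma flexible_cobipartite x1 y1 x2 y2 : nonedge x1 y1 -> nonedge x2 y2 ->
  t1 x1 = t2 x1 -> t1 x2 != t2 x2 ->
  (forall x y, nonedge x y -> t1 x != t2 x -> beyond u x = beyond u y) -> False.
Proof.
move=> n1 n2 a1 d2 eqE; have [f1 f2] := (nonedge_flip n1, nonedge_flip n2).
case/and3P: (n1) => ux1 uy1 nxy1; case/and3P: (n2) => ux2 uy2 nxy2.
have b1 : t1 y1 = t2 y1 by rewrite f1.1 f1.2 a1.
have d2' : t1 y2 != t2 y2 by rewrite f2.1 f2.2; case: (t1 x2) (t2 x2) d2 => [] [].
pose C v := [&& e u v, [exists v', nonedge v v'] & t1 v != t2 v].
have Cx2 : C x2 by rewrite /C ux2 d2 andbT; apply/existsP; exists y2.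
have Cy2 : C y2 by rewrite /C uy2 d2' andbT; apply/existsP; exists x2; rewrite nonedge_sym.
pose Z := beyond u x2.
(* Compare with the pair x1 y1 of the first part. *)
have CZ v : C v -> beyond u v = Z.
  case/and3P=> uv /existsP[v' nv] dv.
  have := beyond_union n1 nv a1 dv; rewrite (beyond_union n1 n2 a1 d2).
  by rewrite -(eqE v v' nv dv) -(eqE x2 y2 n2 d2) !setUid.
have CD v d : C v -> e u d -> ~~ C d -> e v d.
  move=> Cv ud nCd; case/and3P: (Cv) => uv _ dv.
  apply: near_e; last by apply: contraNneq nCd => <-.
  apply: contraNT nCd => nvd; have nv : nonedge d v by rewrite /nonedge ud uv near_sym.
  rewrite /C ud /=; apply/andP; split; first by apply/existsP; exists v.
  have [g1 g2] := nonedge_flip nv; move: dv; rewrite g1 g2.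
  by case: (t1 d) (t2 d) => [] [].
have Ze v l : C v -> l \in Z -> e v l by move=> /CZ <-; rewrite inE => /andP[].
(* The second endpoint of an edge leaving the neighbourhood of u is adjacent to
   x2 or y2, by the absence of claws. *)
have toZ v o : e v x2 -> e v y2 -> e v o -> ~~ near u o -> o \in Z.
  move=> vx vy vo nuo; have: o \in beyond u v by rewrite inE vo.
  move/(subsetP (beyond_claw vx vy ux2 uy2 nxy2)).
  by rewrite -(eqE x2 y2 n2 d2) setUid.
pose W v := near u v || (v \in Z).
have [s hs] := ql x2.
pose r v := if C v then t1 v else s v.
have Wx2 v : W v -> ~~ C v -> e x2 v.
  move=> /orP[uv|vZ] nC; last exact: Ze.
  by case/nearE: uv => [<-|uv]; [rewrite e_sym | apply: CD].
have Wr v v' : W v -> W v' -> r v = r v' -> near v v'.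
  have CW x y : C x -> W y -> ~~ C y -> near x y.
    move=> Cx Wy nCy; apply: e_near; case/orP: Wy => [|yZ]; last exact: Ze.
    by case/nearE=> [<-|uy]; [rewrite e_sym; case/and3P: Cx | apply: CD].
  rewrite /r => Wv Wv'; have [Cv|nCv] := boolP (C v); have [Cv'|nCv'] := boolP (C v').
  - by case/and3P: Cv Cv' => uv _ _ /and3P[uv' _ _]; apply: h1.
  - by move=> _; apply: CW.
  - by move=> _; rewrite near_sym; apply: CW.
  - by apply: hs; apply: Wx2.
have Wclosed v o : W v -> e v o -> W o.
  move=> Wv vo; rewrite /W; have [//|nuo /=] := boolP (near u o).
  have [Cv|nCv] := boolP (C v); first by rewrite -(CZ v Cv) inE vo.
  have [vu|vu] := eqVneq v u; first by case/negP: nuo; rewrite -vu e_near.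
  apply: (toZ v) => //; rewrite e_sym.
    exact: Wx2.
  case/orP: Wv => [uv|vZ]; last exact: Ze.
  by apply: CD => //; apply: near_e; rewrite // eq_sym.
have uW v : e u v -> W v by rewrite /W => /e_near->.
pose S := [set v | W v && r v]; pose T := [set v | W v && ~~ r v].
have WST v : W v -> v \in S \/ v \in T.
  by move=> Wv; rewrite !inE Wv; case: (r v); [left|right].
have pick x y : nonedge x y -> exists2 z, (z == x) || (z == y) & z \in T.
  case/and3P=> ux uy nxy; case rx: (r x); last first.
    by exists x; rewrite ?eqxx // inE uW // rx.
  exists y; rewrite ?eqxx ?orbT // inE uW //=; apply: contra nxy => ry.
  by apply: Wr; rewrite ?uW // rx ry.
have [z1 z1E z1T] := pick x1 y1 n1; have [z2 z2E z2T] := pick x2 y2 n2.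
apply: noslack; apply: (@slack_pair S T S z1 z2) => //.
- by move=> x y; rewrite !inE => /andP[Wx rx] /andP[Wy ry]; apply: Wr; rewrite ?rx ?ry.
- move=> x y; rewrite !inE => /andP[Wx rx] /andP[Wy ry]; apply: Wr => //.
  by rewrite (negbTE rx) (negbTE ry).
- move=> x; rewrite inE => /andP[Wx _]; case/orP: Wx => [/nearE[<-|ux]|xZ].
  + by exists x1.
  + by exists u; rewrite e_sym.
  + by exists x2; rewrite e_sym Ze.
- move=> x; rewrite inE => /andP[Wx _] v v'; rewrite !inE => /andP[xv nS] /andP[xv' nS'].
  have [Wv Wv'] := (Wclosed x v Wx xv, Wclosed x v' Wx xv').
  by apply: Wr => //; move: nS nS'; rewrite Wv Wv' /= => /negbTE-> /negbTE->.
- have a3 : t1 z1 = t2 z1 by case/orP: z1E => /eqP->.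
  have d3 : t1 z2 != t2 z2 by case/orP: z2E => /eqP->.
  by apply: contraNneq d3 => <-; apply/eqP.
- by move: z1T; rewrite !inE => /andP[-> ->].
- by move: z2T; rewrite !inE => /andP[-> ->].
move=> y v yE yv; have Wy : W y.
  by move: yE z1T z2T; rewrite !inE => /orP[]/eqP-> /andP[? _] /andP[? _].
by case: (WST v (Wclosed y v Wy yv)); [constructor 1|constructor 2].
Qed.

End Flexible.

(** If one nonadjacent pair of the second part sees different sets beyond [u],
then no pair of the first part does, and complementing [t2] exchanges the
parts. *)
Lemma colourings_rigid u t1 t2 x1 y1 x2 y2 : halves u t1 -> halves u t2 ->
  nonedge u x1 y1 -> nonedge u x2 y2 -> t1 x1 = t2 x1 -> t1 x2 != t2 x2 -> False.
Proof.
move=> h1 h2 n1 n2 a1 d2.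
pose bad x y := [&& nonedge u x y, t1 x != t2 x & beyond u x != beyond u y].
have [/existsP[x /existsP[y /and3P[nxy dx bxy]]]|ok] :=
  boolP [exists x, exists y, bad x y]; last first.
  apply: (flexible_cobipartite h1 h2 n1 n2 a1 d2) => x y nxy dx.
  by move/existsPn/(_ x)/existsPn/(_ y): ok; rewrite /bad nxy dx negbK => /eqP.
have h2' : halves u (fun v => ~~ t2 v).
  by move=> v v' uv uv' /negb_inj; apply: h2.
apply: (flexible_cobipartite h1 h2' n2 n1).
- by case: (t1 x2) (t2 x2) d2 => [] [].
- by rewrite a1; case: (t2 x1).
move=> v v' nv dv; have av : t1 v = t2 v.
  by case: (t1 v) (t2 v) dv => [] [].
by case: (beyond_equal h1 h2 nv nxy av dx) => // /eqP; rewrite (negbTE bxy).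
Qed.

(** * Ends and walks *)
Definition maxclq (K : {set V}) := clq K /\ forall v, all_near K v -> v \in K.

Lemma maxclq_ext K : clq K -> exists2 K', maxclq K' & K \subset K'.
Proof.
move=> cK; pose P (B : {set V}) := [forall x in B, all_near B x].
have PP B : reflect (clq B) (P B).
  apply: (iffP forall_inP) => [h x y xB yB|cB x xB]; first exact: (all_nearP (h x xB)).
  by apply/all_nearP=> y; apply: cB.
have [K' /maxsetP[/PP cK' maxK'] sub] := maxset_exists (introT (PP K) cK).
exists K' => //; split=> // v vK'; suff <- : v |: K' = K' by rewrite setU11.
apply: maxK'; last exact: subsetUr.
apply/PP=> x y; rewrite !inE => /predU1P[->|xK] /predU1P[->|yK].
- exact: nearxx.
- exact: (all_nearP vK').
- by rewrite near_sym (all_nearP vK').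
- exact: cK'.
Qed.

Lemma maxclq_far A B : maxclq A -> maxclq B -> A != B ->
  exists x y, [/\ x \in A, x \notin B, y \in B, y \notin A & ~~ near x y].
Proof.
move=> [cA mA] [cB mB] nAB.
have /subsetPn[y yB yA] : ~~ (B \subset A).
  apply: contra nAB => sBA; rewrite eqEsubset sBA andbT.
  apply/subsetP=> x xA; apply: mB; apply/all_nearP=> z /(subsetP sBA).
  exact: cA.
have [x xA nyx] : exists2 x, x \in A & ~~ near y x.
  by apply: all_nearPn; apply: contra yA; apply: mA.
exists x, y; rewrite near_sym; split=> //.
by apply: contra nyx => xB; apply: cB.
Qed.

Lemma clique_ends : exists c : V -> bool -> {set V}, forall w,
  [/\ forall b, maxclq (c w b), forall b, w \in c w b
    & forall b v, e w v -> v \notin c w b -> v \in c w (~~ b)].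
Proof.
suff /choice[c hc] : forall w, exists c : bool -> {set V},
    [/\ forall b, maxclq (c b), forall b, w \in c b
      & forall b v, e w v -> v \notin c b -> v \in c (~~ b)] by exists c.
move=> w; have [s hs] := ql w; pose K b := w |: [set v | e w v && (s v == b)].
have cK b : clq (K b).
  move=> x y; rewrite !inE => /predU1P[->|/andP[wx /eqP sx]] /predU1P[->|/andP[wy /eqP sy]].
  - exact: nearxx.
  - exact: e_near.
  - by rewrite near_sym e_near.
  - by apply: hs; rewrite ?sx ?sy.
have [M1 m1 s1] := maxclq_ext (cK true); have [M0 m0 s0] := maxclq_ext (cK false).
have sub b : K b \subset if b then M1 else M0 by case: b.
exists (fun b => if b then M1 else M0); split=> [[]|b|b v wv] //.
  by apply: (subsetP (sub b)); rewrite setU11.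
move=> nv; apply: (subsetP (sub (~~ b))); rewrite !inE wv /=.
have: v \notin K b by apply: contra nv; apply: (subsetP (sub b)).
by rewrite !inE wv negb_or /=; case: (s v) b {nv} => [] []; rewrite ?orbT ?andbF.
Qed.

Section Walk.
Variable c : V -> bool -> {set V}.
Hypothesis hc : forall w,
  [/\ forall b, maxclq (c w b), forall b, w \in c w b
    & forall b v, e w v -> v \notin c w b -> v \in c w (~~ b)].

(** Some [p] in the end [A] has a clique as its neighbourhood outside [A]
([stuck_anchored]).  If [A] were not an end of [p], then membership in [A] and
membership in an end of [p] would be two colourings of the neighbourhood of [p]
excluded by [colourings_rigid]. *)
Lemma end_shared w x b : e w x ->
  exists w' b', w' != w /\ c w' b' = c w b.
Proof.
move=> wx; have [mcw cw cov] := hc w; have [cA mA] := mcw b.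
set A := c w b in cA mA *; have wA : w \in A by apply: cw.
pose good p := [forall x, forall y,
  [&& e p x, e p y, x \notin A & y \notin A] ==> near x y].
have [/exists_inP[p pA /andP[pw pgood]]|nogood] :=
    boolP [exists p in A, (p != w) && good p]; last first.
  case: noslack; have [p0 p0A p0w] : exists2 p0, p0 \in A & p0 != w.
    have [xA|xA] := boolP (x \in A).
      by exists x => //; apply: contraTneq wx => ->; rewrite e_irr.
    have [p0 p0A nxp] : exists2 p0, p0 \in A & ~~ near x p0.
      by apply: all_nearPn; apply: contra xA; apply: mA.
    by exists p0 => //; apply: contraNneq nxp => ->; rewrite near_sym e_near.
  have cB : clq [set v | e w v & v \notin A].
    move=> y z; rewrite !inE => /andP[wy yA] /andP[wz zA].
    by apply: (mcw (~~ b)).1; apply: cov.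
  have [|t [p [p' [q [q']]]]] := stuck_anchored cA wA mA cB p0A p0w.
    move=> p pA pw; move/exists_inPn/(_ p pA): nogood; rewrite pw /=.
    case/forallPn=> y /forallPn[z]; rewrite negb_imply => /andP[/and4P[py pz yA zA] nyz].
    by exists y, z.
  exact: anchored_slack.
have [mcp cp covp] := hc p.
have [A1|A1] := eqVneq A (c p true); first by exists p, true.
have [A0|A0] := eqVneq A (c p false); first by exists p, false.
have mcA : maxclq A by split.
have [x2 [y2 [x2A x2P y2P y2A n2]]] := maxclq_far mcA (mcp true) A1.
have [x1 [y1 [x1A x1Q y1Q y1A n1]]] := maxclq_far mcA (mcp false) A0.
have adj v : near p v -> v \notin A \/ (exists b', v \notin c p b') -> e p v.
  by move=> pv h; apply: near_e => //; case: h => [|[b']]; apply: contraNneq => <-.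
have px1 : e p x1 by apply: adj; [apply: cA | right; exists false].
have px2 : e p x2 by apply: adj; [apply: cA | right; exists true].
have py1 : e p y1 by apply: adj; [apply: (mcp false).1 | left].
have py2 : e p y2 by apply: adj; [apply: (mcp true).1 | left].
have x1P : x1 \in c p true by apply: (covp false).
have y1P : y1 \notin c p true.
  by apply: contra n1 => y1P; apply: (mcp true).1.
case: (@colourings_rigid p (fun v => v \in A) (fun v => v \in c p true) x1 y1 x2 y2).
- move=> v z pv pz vz; have [vA|vA] := boolP (v \in A); first by apply: cA; rewrite -?vz.
  by move/forallP/(_ v)/forallP/(_ z): pgood; rewrite pv pz vA -vz vA.
- move=> v z pv pz vz; have [vA|vA] := boolP (v \in c p true).
    by apply: (mcp true).1; rewrite -?vz.
  by apply: (mcp false).1; apply: (covp true); rewrite // -vz.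
- by rewrite /nonedge px1 py1.
- by rewrite /nonedge px2 py2.
- by rewrite x1A x1P.
- by rewrite x2A (negbTE x2P).
Qed.

(** The list [T] contains the ends met so far.  The walk has reached [w] and is
about to leave through its end [b], which no earlier vertex shares. *)
Definition walk (s : seq V) (T : seq {set V}) w b :=
  [/\ uniq s, size T = (size s).+1, w \in s, {in T, forall K, clq K}
    & {in s, forall x, [/\ exists v, e x v,
         forall d, c x d \in T /\ index (c x d) T <= (index x s).+1
       & x != w -> forall d, c x d != c w b]}].

Lemma walk_start w x : e w x -> exists s T w' b, walk s T w' b.
Proof.
move=> wx; have [mc wc cov] := hc w.
have [c01|c01] := eqVneq (c w true) (c w false).
  case: noslack; exists [:: w], (fun=> c w true); split=> //.
    by move=> y; rewrite inE => /eqP->; exists x.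
  split=> //; first by move=> _; apply: (mc true).1.
  move=> y; rewrite inE => /eqP-> v wv; exists 0; split=> //.
  have [//|nv] := boolP (v \in c w true).
  by have /= := cov true v wv nv; rewrite -c01 (negbTE nv).
exists [:: w], [:: c w true; c w false], w, false; split=> //.
- by rewrite inE.
- by move=> K; rewrite !inE => /orP[]/eqP->; [case: (mc true)|case: (mc false)].
move=> y; rewrite inE => /eqP->; split; first by exists x.
  by case; rewrite !inE /= !eqxx ?(negbTE c01) ?orbT.
by rewrite eqxx.
Qed.

Lemma index_rcons (T : eqType) (s : seq T) x y :
  y \in s -> index y (rcons s x) = index y s.
Proof. by move=> ys; rewrite -cats1 index_cat ys. Qed.

Lemma index_last (T : eqType) (s : seq T) x :
  x \notin s -> index x (rcons s x) = size s.
Proof. by move=> xs; rewrite -cats1 index_cat (negbTE xs) /= eqxx addn0. Qed.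

(** Another vertex sharing the end by which the walk leaves [w] is new.  If its
second end has been met before, the vertices listed so far are a slack;
otherwise that end is shared by no vertex listed before, and the walk goes
on. *)
Lemma walk_step s T w b : walk s T w b ->
  exists w' K b', walk (rcons s w') (rcons T K) w' b'.
Proof.
case=> us sT ws cT hs; have [[x wx] hw _] := hs w ws.
have [w' [b' [nw' K']]] := end_shared b wx.
have w's : w' \notin s.
  apply/negP=> w's; have [_ _ /(_ nw' b')] := hs w' w's.
  by rewrite K' eqxx.
have [mc wc cov] := hc w'.
have w'w : e w' w.
  by apply: near_e; rewrite // (mc b').1 // K'; have [_ + _] := hc w; apply.
have KT : c w' b' \in T by rewrite K'; case: (hw b).
have us' : uniq (rcons s w') by rewrite rcons_uniq w's.
have [K'T|K'T] := boolP (c w' (~~ b') \in T).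
  case: noslack; exists (rcons s w'), (nth set0 T); split.
  - by case: (s).
  - by move=> y; rewrite mem_rcons inE => /predU1P[->|/hs[]]; first by exists w.
  split=> //.
    move=> j; have [jT|jT] := ltnP j (size T); first by apply: cT; apply: mem_nth.
    by rewrite nth_default // => y z; rewrite inE.
  have in_end y v d : c y d \in T -> index (c y d) T <= (index y (rcons s w')).+1 ->
      y \in c y d -> v \in c y d -> exists j,
      [/\ j <= (index y (rcons s w')).+1, j < size (rcons s w'),
          y \in nth set0 T j & v \in nth set0 T j].
    move=> ydT idx yd vd; exists (index (c y d) T); split=> //.
    - by rewrite size_rcons -sT index_mem.
    - by rewrite nth_index.
    - by rewrite nth_index.
  move=> y yS v yv; have [_ yc ycov] := hc y.
  have yT d : c y d \in T /\ index (c y d) T <= (index y (rcons s w')).+1.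
    move: yS; rewrite mem_rcons inE => /predU1P[->|ys]; last first.
      by have [_ /(_ d)] := hs y ys; rewrite index_rcons.
    have dT : c w' d \in T by move: KT K'T; clear K'; case: d; case: b'.
    by split; rewrite // index_last // -sT ltnW // index_mem.
  have [vt|vt] := boolP (v \in c y true).
    by case: (yT true) => ? ?; apply: (in_end y v true).
  by case: (yT false) => ? ?; apply: (in_end y v false); rewrite // (ycov true).
exists w', (c w' (~~ b')), (~~ b'); split=> //.
- by rewrite !size_rcons sT.
- by rewrite mem_rcons mem_head.
- by move=> K; rewrite mem_rcons inE => /predU1P[->|/cT //]; case: (mc (~~ b')).
move=> y; rewrite mem_rcons inE => /predU1P[->|ys].
  split; [by exists w | | by rewrite eqxx].
  move=> d; rewrite mem_rcons inE index_last //.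
  have [->|db] := eqVneq d (~~ b'); first by rewrite eqxx index_last // sT.
  have -> : d = b' by move: db; case: (d); case: (b').
  by rewrite KT orbT index_rcons // -sT; split; rewrite // ltnW // index_mem.
have [yv yT _] := hs y ys; split=> // [d|_ d].
  by have [dT idx] := yT d; rewrite mem_rcons inE dT orbT !index_rcons.
by apply: contraNneq K'T => <-; case: (yT d).
Qed.

End Walk.

Lemma noslack_edgeless x y : e x y -> False.
Proof.
move=> xy; have [c hc] := clique_ends.
have [s [T [w [b hw]]]] := walk_start hc xy.
have [n] := ubnP (#|V| - size s); elim: n s T w b hw => // n IHn s T w b hw lt_n.
have [w' [K [b' hw']]] := walk_step hc hw; apply: (IHn _ _ _ _ hw').
have /card_uniqP us : uniq (rcons s w') by case: hw'.
have := max_card (mem (rcons s w')); rewrite us size_rcons => szV.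
by rewrite subnS -ltnS prednK ?subn_gt0 //; apply: leq_trans lt_n.
Qed.

End NoSlack.

Lemma edge_slack x y : e x y -> slack.
Proof.
move=> xy; apply: contrapT => ns; exact: noslack_edgeless ns _ _ xy.
Qed.

End QuasiLine.

(** * From slacks to an acyclic digraph *)

(** Slacks are taken off one after the other.  An edge between a slack and the
remaining vertices is covered from the side of the slack, whose vertices are
listed first. *)
Lemma schedule_exists (V : finType) (D : {set V}) (e : rel V) :
  symmetric e -> irreflexive e -> (forall v, exists s, halves e v s) ->
  (forall x y, e x y -> x \in D) ->
  exists s F, [/\ uniq s, s =i D, forall j, clq e (F j)
    & forall x v, e x v -> exists j,
        [/\ j <= (index x s).+1, x \in F j & v \in F j]].
Proof.
have [n] := ubnP #|D|; elim: n D e => // n IHn D e; rewrite ltnS => le_n.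
move=> e_sym e_irr ql dom.
have [/exists_inP[x xD /forallP iso]|noiso] :=
  boolP [exists x in D, [forall y, ~~ e x y]].
  have lt_n : #|D :\ x| < n by apply: leq_trans le_n; rewrite (cardsD1 x D) xD.
  have [y v yv|s [F [us sD cF cov]]] := IHn (D :\ x) e lt_n e_sym e_irr ql.
    by rewrite !inE (dom y v yv) andbT; apply: contraTneq yv => ->; apply: iso.
  exists (x :: s), F; split=> //.
  - by rewrite /= us sD !inE eqxx.
  - move=> y; rewrite inE sD !inE.
    by have [->|] := eqVneq y x; rewrite ?xD.
  move=> y v yv; have [j [jy yF vF]] := cov y v yv; exists j; split=> //=.
  by case: ifP => [/eqP xy|_]; [move: yv (iso v); rewrite -xy => -> | apply: leqW].
have [D0|[x xD]] := set_0Vmem D.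
  exists [::], (fun=> set0); split=> // [y|j y z|y v /dom]; by rewrite ?D0 inE.
have [s1 [F1 [s1n s1e [us1 cF1 cov1]]]] : slack e.
  move/exists_inPn/(_ x xD): noiso => /forallPn[y]; rewrite negbK.
  exact: edge_slack.
pose e' x y := [&& e x y, x \notin s1 & y \notin s1].
have near_e' a b : near e' a b -> near e a b.
  by case/predU1P => [->|/and3P[ab _ _]]; [apply: nearxx | apply: e_near].
have s1D y : y \in s1 -> y \in D by case/s1e=> v /dom.
pose D' := [set y in D | y \notin s1].
have lt_n : #|D'| < n.
  apply: leq_trans le_n; apply/proper_card/properP; split.
    by apply/subsetP=> y; rewrite inE => /andP[].
  case: (s1) s1n s1D @D' => // y s1' _ s1D; exists y; first by rewrite s1D ?mem_head.
  by rewrite !inE eqxx andbF.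
have [||v|y v|s2 [F2 [us2 s2D cF2 cov2]]] := IHn D' e' lt_n.
- by move=> y z; rewrite /e' e_sym andbCA andbC -!andbA; congr (_ && _); rewrite andbC.
- by move=> y; rewrite /e' e_irr.
- have [s hs] := ql v; exists s => a b /and3P[va nv na] /and3P[vb _ nb] sab.
  have := hs a b va vb sab; rewrite /near /e' na nb !andbT.
  by [].
- by case/and3P=> yv ny nv; rewrite inE ny (dom _ _ yv).
exists (s1 ++ s2), (fun j => if j < size s1 then F1 j else F2 (j - size s1)).
have s12 y : y \in s2 -> y \notin s1 by rewrite s2D inE => /andP[].
split.
- rewrite cat_uniq us1 us2 andbT /=; apply/hasPn => y /s12; exact.
- move=> y; rewrite mem_cat s2D inE.
  by have [/s1D->|] := boolP (y \in s1); rewrite //= andbT.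
- move=> j; case: ifP => _; first exact: cF1.
  by move=> a b aF bF; apply: near_e'; apply: (cF2 _ _ _ aF bF).
move=> y v yv; have [ys1|ys1] := boolP (y \in s1).
  have [j [jy js yF vF]] := cov1 y ys1 v yv.
  by exists j; rewrite js index_cat ys1.
have szy : size s1 <= index y (s1 ++ s2) by rewrite index_cat (negbTE ys1) leq_addr.
have [vs1|vs1] := boolP (v \in s1).
  have [|j [jy js vF yF]] := cov1 v vs1 y; first by rewrite e_sym.
  by exists j; rewrite js; split=> //; apply: leqW; apply: leq_trans szy; apply: ltnW.
have [|j [jy yF vF]] := cov2 y v; first by rewrite /e' yv ys1.
exists (size s1 + j); rewrite ltnNge leq_addr /= addKn; split=> //.
by rewrite index_cat (negbTE ys1) -addnS leq_add2l.
Qed.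

Lemma ranked_acyclic (W : finType) (d : rel W) (r : W -> nat) :
  (forall a b, d a b -> r b < r a) -> acyclic d.
Proof.
move=> dr [|a p] // /andP[/= pd _].
have tr : transitive (fun x y => r y < r x) by move=> y x z /[swap]; apply: ltn_trans.
have := order_path_min tr (sub_path dr pd).
by rewrite all_rcons ltnn.
Qed.

(** The in-neighbours of a vertex are taken among the vertices listed after it,
which makes the digraph acyclic. *)
Lemma schedule_competition (G : sgraph) (s : seq G) (F : nat -> {set G}) :
  uniq s -> (forall x, x \in s) -> (forall j, clq (@adj G) (F j)) ->
  (forall x v, adj x v -> exists j,
     [/\ j <= (index x s).+1, x \in F j & v \in F j]) ->
  is_competition_graph (add_isolated G 2).
Proof.
move=> us sG cF cov.
pose d : rel (add_isolated G 2) := fun a b =>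
  match a, b with
  | inl u, inl x => (u \in F (index x s).+2) && (index x s < index u s)
  | inl u, inr i => u \in F i
  | inr _, _ => false
  end.
exists d.
  apply: (@ranked_acyclic _ d (fun a => if a is inl u then (index u s).+1 else 0)).
  by move=> [u|i] [x|j] //= /andP[].
have prey u v : index u s <= index v s -> adj u v -> exists w, d (inl u) w && d (inl v) w.
  move=> uv /cov[[|[|k]] [ku uF vF]].
  - by exists (inr (Ordinal (isT : 0 < 2))); rewrite /= uF vF.
  - by exists (inr (Ordinal (isT : 1 < 2))); rewrite /= uF vF.
  have ku' : k < index u s by rewrite -ltnS.
  have ks : k < size s by rewrite (ltn_trans ku') // index_mem.
  exists (inl (nth u s k)); rewrite /= index_uniq // uF vF ku' /=.
  exact: leq_trans uv.
case=> [u|i] [v|j] //=; rewrite /competition_adj; last first.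
- by apply/esym/negbTE/negP => /andP[_ /existsP[]].
- by apply/esym/negbTE/negP => /andP[_ /existsP[]].
- by apply/esym/negbTE/negP => /andP[_ /existsP[w]]; rewrite andbF.
apply/idP/andP => [uv|[neq_uv /existsP[w /andP[uw vw]]]].
  split; first by apply: contraTneq uv => -[->]; rewrite adj_irrefl.
  apply/existsP; have [le_uv|/ltnW le_vu] := leqP (index u s) (index v s).
    exact: prey.
  have [|w] := prey v u le_vu; first by rewrite adj_sym.
  by rewrite andbC; exists w.
have [j uF vF] : exists2 j, u \in F j & v \in F j.
  by case: w uw vw => [x|j] /=; [move=> /andP[uF _] /andP[vF _]; exists (index x s).+2 | exists j].
by apply: near_e; [apply: (cF j) | apply: contraNneq neq_uv => ->].
Qed.

Theorem theorem18 (G : sgraph) (hG : quasi_line G) : competition_number G <= 2.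
Proof.
rewrite /competition_number; case: ex_minnP => m _; apply; apply/asboolP.
have ql v : exists s, halves (@adj G) v s.
  have [A [B [cA cB _ AB]]] := hG v; exists (fun x => x \in A) => a b va vb ab.
  have inAB x : adj v x -> x \notin A -> x \in B.
    by move=> vx xA; move: (in_setU x A B); rewrite AB inE vx (negbTE xA).
  rewrite /near; have [//|nab] := eqVneq a b; have [aA|aA] := boolP (a \in A).
    by apply: cA => //; rewrite -ab.
  by apply: cB; rewrite ?inAB // -ab.
have [//|s [F [us sT cF cov]]] :=
  schedule_exists (D := setT) (@adj_sym G) (@adj_irrefl G) ql.
by apply: (schedule_competition us _ cF cov) => x; rewrite sT inE.
Qed.
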